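(* For all $\Phi\cup\{\varphi\}\subseteq Fm(C)$: $\Phi\Vdash_3\varphi\Leftrightarrow\Phi\vdash_3\varphi$. (The analogous statements hold for $S4^\forall_\equiv$ and $S5^\forall_\equiv$.)
   Context: Language: $Fm(C)$ is the set of formulas built from propositional variables $V$, a set $C$ of propositional constants containing $\top,\bot$, connectives $\neg,\rightarrow,\vee,\wedge$, identity connective $\equiv$, necessity $\square$ and universal propositional quantifier $\forall$ ($\forall x\varphi$ formed only if $x$ free in $\varphi$). $\varphi[x:=\psi]$ is capture-avoiding substitution; $=_\alpha$ is alpha-congruence. The system $S3^\forall_\equiv$ has axioms: (i) substitution-instances of propositional tautologies; (ii) $\square\varphi\rightarrow\varphi$; (iii) $\square(\varphi\rightarrow\psi)\rightarrow(\square\varphi\rightarrow\square\psi)$; (iv) $\square(\varphi\rightarrow\psi)\rightarrow\square(\square\varphi\rightarrow\square\psi)$; (v) $\varphi\equiv\psi$ if $\varphi=_\alpha\psi$; (vi) $(\varphi\equiv\psi)\rightarrow(\varphi\rightarrow\psi)$; (vii) $(\psi\equiv\psi')\rightarrow(\varphi[x:=\psi]\equiv\varphi[x:=\psi'])$, $x$ free in $\varphi$; (viii) $\forall x(\varphi\equiv\psi)\rightarrow(\forall x\varphi\equiv\forall x\psi)$; (ix) $\forall x\varphi\rightarrow\varphi[x:=\psi]$; (x) $\forall x(\varphi\rightarrow\psi)\rightarrow(\forall x\varphi\rightarrow\forall x\psi)$; (xi) $\forall x(\varphi\rightarrow\psi)\rightarrow(\varphi\rightarrow\forall x\psi)$,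 $x$ not free in $\varphi$; (xii) $\square\forall x\varphi\rightarrow\forall x\square\varphi$; (xiii) $\forall x\square\varphi\rightarrow\square\forall x\varphi$; closed under: $\varphi$ axiom and $x$ free in $\varphi$ implies $\forall x\varphi$ axiom. Rules: Modus Ponens and Axiom Necessitation (from an axiom $\varphi$ infer $\square\varphi$). $\vdash_3$ is derivability in $S3^\forall_\equiv$; $S4^\forall_\equiv$ adds $\square\varphi\rightarrow\square\square\varphi$, $S5^\forall_\equiv$ further adds $\neg\square\varphi\rightarrow\square\neg\square\varphi$. Semantics: a propositional domain is $\mathcal{M}=(M,\mathit{TRUE},\mathit{NEC},f_\bot,f_\top,f_\square,f_\neg,f_\vee,f_\wedge,f_\rightarrow,f_\equiv,f_\forall,\varGamma)$ with $\mathit{TRUE},\mathit{NEC}\subseteq M$, operations of obvious arities, $f_\forall\colon M^M\to M$, $\varGamma\colon C\to M$ with $\varGamma(\bot)=f_\bot,\varGamma(\top)=f_\top$; assignments $\gamma\colon V\to M$ extend homomorphically with $\gamma(c)=\varGamma(c)$ and $\gamma(\forall x\varphi)=f_\forall(m\mapsto\gamma_x^m(\varphi))$. $t\colon M\to M$ is $(\varphi,x,\gamma)$-definable if $t(m)=\gamma_x^m(\varphi)$ for all $m$ (definable if so for some $\varphi,x,\gamma$). With $a\le_\mathcal{M}b:\Leftrightarrow f_\rightarrow(a,b)\in\mathit{NEC}$ and $\approx_\mathcal{M}$ its symmetric part, $\mathcal{M}$ is an $S3^\forall_\equiv$-model if: (1) when $\mathit{NEC}\neq\varnothing$, $\le_\mathcal{M}$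 is a preorder making $(M,f_\bot,f_\top,f_\neg,f_\vee,f_\wedge,f_\rightarrow,\le_\mathcal{M})$ a Boolean prealgebra ($\approx_\mathcal{M}$ a congruence with Boolean-algebra quotient ordered by $\le_\mathcal{M}$); (2) $f_\bot\notin\mathit{TRUE}$, $f_\top\in\mathit{TRUE}$, classical truth conditions for $f_\rightarrow,f_\neg,f_\wedge,f_\vee$, $f_\square(a)\in\mathit{TRUE}\Leftrightarrow a\in\mathit{NEC}$, $f_\equiv(a,b)\in\mathit{TRUE}\Leftrightarrow a=b$, $f_\forall(t)\in\mathit{TRUE}$ for definable $t$ with image in $\mathit{TRUE}$; (3) when $\mathit{NEC}\neq\varnothing$, $\mathit{NEC}\subseteq\mathit{TRUE}$ is upward closed under $\le_\mathcal{M}$ and closed under $f_\wedge$; (4) when $\mathit{NEC}\neq\varnothing$: $f_\top\le_\mathcal{M}f_\equiv(a,a)$; $f_\equiv(a,b)\le_\mathcal{M}f_\rightarrow(a,b)$; $f_\equiv(a,b)\le_\mathcal{M}f_\equiv(t(a),t(b))$ for definable $t$; $f_\square(a)\le_\mathcal{M}a$; $f_\square(f_\rightarrow(a,b))\le_\mathcal{M}f_\rightarrow(f_\square(a),f_\square(b))$; $f_\square(f_\rightarrow(a,b))\le_\mathcal{M}f_\square(f_\rightarrow(f_\square(a),f_\square(b)))$; $f_\forall(t)\le_\mathcal{M}f_\equiv(f_\forall(t_1),f_\forall(t_2))$ and $f_\forall(t)\le_\mathcal{M}f_\rightarrow(f_\forall(t_1),f_\forall(t_2))$ for $t_1,t_2$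 $(\varphi,x,\gamma)$-, $(\psi,x,\gamma)$-definable and $t$ the pointwise $f_\equiv$, resp. $f_\rightarrow$, of $t_1,t_2$; $f_\forall(t)\le_\mathcal{M}t(a)$ for definable $t$; $f_\forall(t)\le_\mathcal{M}f_\rightarrow(b,f_\forall(t'))$ for $t'$ $(\psi,x,\gamma)$-definable, $b$ the denotation of a sentence and $t(a)=f_\rightarrow(b,t'(a))$; $f_\square(f_\forall(t))\approx_\mathcal{M}f_\forall(a\mapsto f_\square(t(a)))$ for definable $t$; $f_\forall(t)\in\mathit{NEC}$ for definable $t$ with image in $\mathit{NEC}$. It is normal if $\mathit{NEC}\neq\varnothing$. A normal $S3^\forall_\equiv$-model is an $S4^\forall_\equiv$-model if $f_\square(a)\le_\mathcal{M}f_\square(f_\square(a))$ for all $a$; an $S4^\forall_\equiv$-model is an $S5^\forall_\equiv$-model if $f_\neg(f_\square(a))\le_\mathcal{M}f_\square(f_\neg(f_\square(a)))$ for all $a$. $(\mathcal{M},\gamma)\vDash\varphi:\Leftrightarrow\gamma(\varphi)\in\mathit{TRUE}$. $\Phi\Vdash_3\varphi$ iff for all normal $S3^\forall_\equiv$-models $\mathcal{M}$ and assignments $\gamma$, $(\mathcal{M},\gamma)\vDash\Phi$ implies $(\mathcal{M},\gamma)\vDash\varphi$ (analogously $\Vdash_4,\Vdash_5$).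
   Formalization: Two model clauses in (4) are corrected, since literally the theorem fails: f_∀(t) ≤ f_≡(f_∀(t1), f_∀(t2)) is required only when x is free in both defining formulas, and in the clause for axiom (xi) b is the denotation of any formula without x free, not only of a closed sentence. *)

(* Defs.v *)
From mathcomp Require Import all_boot.
From mathcomp Require Import boolp classical_sets.

Set Implicit Arguments.
Unset Strict Implicit.
Unset Printing Implicit Defensive.

(** * Syntax *)

Record constants := Constants {
  const_sort :> Type;
  ctop : const_sort;
  cbot : const_sort;
  ctop_neq_cbot : ctop <> cbot }.

(** Raw formulas, over the denumerable set [nat] of variables. The raw type
    allows vacuous quantifiers; the formulas of the language are the members
    of [Fm] below. *)
Inductive form (C : constants) : Type :=
| Var of nat
| Cst of C
| Neg of form C
| Imp of form C & form C
| Or of form C & form C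
| And of form C & form C
| Eqv of form C & form C
| Box of form C
| All of nat & form C.

Arguments Var {C} _.
Arguments Cst {C} _.

Fixpoint fv (C : constants) (A : form C) : seq nat :=
  match A with
  | Var x => [:: x]
  | Cst _ => [::]
  | Neg A | Box A => fv A
  | Imp A B | Or A B | And A B | Eqv A B => fv A ++ fv B
  | All x A => [seq y <- fv A | y != x]
  end.

Fixpoint Fm (C : constants) (A : form C) : Prop :=
  match A with
  | Var _ | Cst _ => True
  | Neg A | Box A => Fm A
  | Imp A B | Or A B | And A B | Eqv A B => Fm A /\ Fm B
  | All x A => x \in fv A /\ Fm A
  end.

Definition upd (T : Type) (g : nat -> T) (x : nat) (a : T) : nat -> T :=
  fun y => if y == x then a else g y.

Definition fresh (s : seq nat) : nat := (foldr maxn 0 s).+1.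

(** Simultaneous capture-avoiding substitution; a bound variable is renamed
    only if it would capture a variable of a substituted formula. *)
Fixpoint msubst (C : constants) (s : nat -> form C) (A : form C) : form C :=
  match A with
  | Var x => s x
  | Cst c => Cst c
  | Neg A => Neg (msubst s A)
  | Imp A B => Imp (msubst s A) (msubst s B)
  | Or A B => Or (msubst s A) (msubst s B)
  | And A B => And (msubst s A) (msubst s B)
  | Eqv A B => Eqv (msubst s A) (msubst s B)
  | Box A => Box (msubst s A)
  | All y A =>
      let avoid := flatten [seq fv (s v) | v <- fv A & v != y] in
      let z := if y \in avoid then fresh avoid else y in
      All z (msubst (upd s y (Var z)) A)
  end.

Definition subst (C : constants) (A : form C) (x : nat) (B : form C) : form C :=
  msubst (upd (@Var C) x B) A.

Inductive alpha (C : constants) : form C -> form C -> Prop :=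
| alpha_rename x y A : y \notin fv A ->
    alpha (All x A) (All y (subst A x (Var y)))
| alpha_refl A : alpha A A
| alpha_sym A B : alpha A B -> alpha B A
| alpha_trans A B D : alpha A B -> alpha B D -> alpha A D
| alpha_neg A A' : alpha A A' -> alpha (Neg A) (Neg A')
| alpha_imp A A' B B' : alpha A A' -> alpha B B' ->
    alpha (Imp A B) (Imp A' B')
| alpha_or A A' B B' : alpha A A' -> alpha B B' -> alpha (Or A B) (Or A' B')
| alpha_and A A' B B' : alpha A A' -> alpha B B' ->
    alpha (And A B) (And A' B')
| alpha_eqv A A' B B' : alpha A A' -> alpha B B' ->
    alpha (Eqv A B) (Eqv A' B')
| alpha_box A A' : alpha A A' -> alpha (Box A) (Box A')
| alpha_all x A A' : alpha A A' -> alpha (All x A) (All x A').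

(** * Deductive systems *)

Inductive pform : Type :=
| PVar of nat
| PTop
| PBot
| PNeg of pform
| PImp of pform & pform
| POr of pform & pform
| PAnd of pform & pform.

Fixpoint peval (v : nat -> bool) (p : pform) : bool :=
  match p with
  | PVar n => v n
  | PTop => true
  | PBot => false
  | PNeg p => ~~ peval v p
  | PImp p q => peval v p ==> peval v q
  | POr p q => peval v p || peval v q
  | PAnd p q => peval v p && peval v q
  end.

Definition tautology (p : pform) : Prop := forall v, peval v p.

Fixpoint pinst (C : constants) (s : nat -> form C) (p : pform) : form C :=
  match p with
  | PVar n => s n
  | PTop => Cst (ctop C)
  | PBot => Cst (cbot C)
  | PNeg p => Neg (pinst s p)
  | PImp p q => Imp (pinst s p) (pinst s q)
  | POr p q => Or (pinst s p) (pinst s q)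
  | PAnd p q => And (pinst s p) (pinst s q)
  end.

Inductive system := S3 | S4 | S5.

Inductive schema (C : constants) (L : system) : form C -> Prop :=
| sch_taut p s : tautology p -> schema L (pinst s p)
| sch_T A : schema L (Imp (Box A) A)
| sch_K A B : schema L (Imp (Box (Imp A B)) (Imp (Box A) (Box B)))
| sch_S3 A B : schema L (Imp (Box (Imp A B)) (Box (Imp (Box A) (Box B))))
| sch_alpha A B : alpha A B -> schema L (Eqv A B)
| sch_eqv_imp A B : schema L (Imp (Eqv A B) (Imp A B))
| sch_eqv_subst A x B B' : x \in fv A ->
    schema L (Imp (Eqv B B') (Eqv (subst A x B) (subst A x B')))
| sch_eqv_all x A B :
    schema L (Imp (All x (Eqv A B)) (Eqv (All x A) (All x B)))
| sch_inst x A B : schema L (Imp (All x A) (subst A x B))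
| sch_all_imp x A B :
    schema L (Imp (All x (Imp A B)) (Imp (All x A) (All x B)))
| sch_all_const x A B : x \notin fv A ->
    schema L (Imp (All x (Imp A B)) (Imp A (All x B)))
| sch_cbarcan x A : schema L (Imp (Box (All x A)) (All x (Box A)))
| sch_barcan x A : schema L (Imp (All x (Box A)) (Box (All x A)))
| sch_4 A : L <> S3 -> schema L (Imp (Box A) (Box (Box A)))
| sch_5 A : L = S5 -> schema L (Imp (Neg (Box A)) (Box (Neg (Box A)))).

(** [Fm A] forces the conditions of formation on the metavariables of the
    schema, e.g. that [x] is free in both formulas of [sch_eqv_all]. *)
Inductive axiom (C : constants) (L : system) : form C -> Prop :=
| axiom_schema A : Fm A -> schema L A -> axiom L A
| axiom_all x A : x \in fv A -> axiom L A -> axiom L (All x A).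

Inductive derives (C : constants) (L : system) (Phi : set (form C)) :
    form C -> Prop :=
| derives_hyp A : Phi A -> derives L Phi A
| derives_axiom A : axiom L A -> derives L Phi A
| derives_mp A B : derives L Phi A -> derives L Phi (Imp A B) ->
    derives L Phi B
| derives_nec A : axiom L A -> derives L Phi (Box A).

(** * Semantics *)

Record domain (C : constants) := Domain {
  dom :> Type;
  TRUE : set dom;
  NEC : set dom;
  f_bot : dom;
  f_top : dom;
  f_box : dom -> dom;
  f_neg : dom -> dom;
  f_or : dom -> dom -> dom;
  f_and : dom -> dom -> dom;
  f_imp : dom -> dom -> dom;
  f_eqv : dom -> dom -> dom;
  f_all : (dom -> dom) -> dom;
  Gamma : C -> dom;
  Gamma_bot : Gamma (cbot C) = f_bot;
  Gamma_top : Gamma (ctop C) = f_top }.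

Arguments TRUE {C} _ _.
Arguments NEC {C} _ _.
Arguments f_bot {C} _.
Arguments f_top {C} _.

Fixpoint den (C : constants) (M : domain C) (g : nat -> M) (A : form C) : M :=
  match A with
  | Var x => g x
  | Cst c => Gamma M c
  | Neg A => f_neg (den g A)
  | Imp A B => f_imp (den g A) (den g B)
  | Or A B => f_or (den g A) (den g B)
  | And A B => f_and (den g A) (den g B)
  | Eqv A B => f_eqv (den g A) (den g B)
  | Box A => f_box (den g A)
  | All x A => f_all (fun m => den (upd g x m) A)
  end.

Definition definable_by (C : constants) (M : domain C)
    (A : form C) (x : nat) (g : nat -> M) (t : M -> M) : Prop :=
  Fm A /\ forall m, t m = den (upd g x m) A.

Definition definable (C : constants) (M : domain C) (t : M -> M) : Prop :=
  exists A x g, definable_by A x g t.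

Definition leM (C : constants) (M : domain C) (a b : M) : Prop :=
  NEC M (f_imp a b).

Definition eqM (C : constants) (M : domain C) (a b : M) : Prop :=
  leM a b /\ leM b a.

(** The laws of a Boolean algebra are imposed on the quotient by [eqM], i.e.
    they are read with [eqM] in place of equality; [bp_le] says that the
    order of the quotient is the one induced by [leM]. *)
Record boolean_prealgebra (C : constants) (M : domain C) : Prop := {
  bp_refl : forall a : M, leM a a;
  bp_trans : forall a b c : M, leM a b -> leM b c -> leM a c;
  bp_cong_neg : forall a a' : M, eqM a a' -> eqM (f_neg a) (f_neg a');
  bp_cong_or : forall a a' b b' : M, eqM a a' -> eqM b b' ->
    eqM (f_or a b) (f_or a' b');
  bp_cong_and : forall a a' b b' : M, eqM a a' -> eqM b b' ->
    eqM (f_and a b) (f_and a' b');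
  bp_cong_imp : forall a a' b b' : M, eqM a a' -> eqM b b' ->
    eqM (f_imp a b) (f_imp a' b');
  bp_orC : forall a b : M, eqM (f_or a b) (f_or b a);
  bp_andC : forall a b : M, eqM (f_and a b) (f_and b a);
  bp_orA : forall a b c : M, eqM (f_or a (f_or b c)) (f_or (f_or a b) c);
  bp_andA : forall a b c : M,
    eqM (f_and a (f_and b c)) (f_and (f_and a b) c);
  bp_or_and : forall a b : M, eqM (f_or a (f_and a b)) a;
  bp_and_or : forall a b : M, eqM (f_and a (f_or a b)) a;
  bp_distr : forall a b c : M,
    eqM (f_and a (f_or b c)) (f_or (f_and a b) (f_and a c));
  bp_bot : forall a : M, eqM (f_or a (f_bot M)) a;
  bp_top : forall a : M, eqM (f_and a (f_top M)) a;
  bp_or_neg : forall a : M, eqM (f_or a (f_neg a)) (f_top M);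
  bp_and_neg : forall a : M, eqM (f_and a (f_neg a)) (f_bot M);
  bp_imp : forall a b : M, eqM (f_imp a b) (f_or (f_neg a) b);
  bp_le : forall a b : M, leM a b <-> eqM (f_and a b) a }.

Record truth_conditions (C : constants) (M : domain C) : Prop := {
  tc_bot : ~ TRUE M (f_bot M);
  tc_top : TRUE M (f_top M);
  tc_imp : forall a b : M, TRUE M (f_imp a b) <-> (TRUE M a -> TRUE M b);
  tc_neg : forall a : M, TRUE M (f_neg a) <-> ~ TRUE M a;
  tc_and : forall a b : M, TRUE M (f_and a b) <-> TRUE M a /\ TRUE M b;
  tc_or : forall a b : M, TRUE M (f_or a b) <-> TRUE M a \/ TRUE M b;
  tc_box : forall a : M, TRUE M (f_box a) <-> NEC M a;
  tc_eqv : forall a b : M, TRUE M (f_eqv a b) <-> a = b;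
  tc_all : forall t : M -> M, definable t -> (forall a, TRUE M (t a)) ->
    TRUE M (f_all t) }.

Record nec_filter (C : constants) (M : domain C) : Prop := {
  nf_true : forall a : M, NEC M a -> TRUE M a;
  nf_up : forall a b : M, NEC M a -> leM a b -> NEC M b;
  nf_and : forall a b : M, NEC M a -> NEC M b -> NEC M (f_and a b) }.

(** In [nc_all_eqv] the variable is required to be free in both formulas, as
    it must be for [All x A] and [All x B] to be formulas. Extended to constant
    functions, which no quantified formula has to denote, the clause would
    validate formulas underivable in S3 and S4. In [nc_all_const], [b] is the denotation of
    any formula without free [x], as in [sch_all_const]; restricted to closed
    formulas, the clause would not validate that schema. *)
Record nec_conditions (C : constants) (M : domain C) : Prop := {
  nc_eqv_refl : forall a : M, leM (f_top M) (f_eqv a a);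
  nc_eqv_imp : forall a b : M, leM (f_eqv a b) (f_imp a b);
  nc_eqv_subst : forall (t : M -> M) (a b : M), definable t ->
    leM (f_eqv a b) (f_eqv (t a) (t b));
  nc_T : forall a : M, leM (f_box a) a;
  nc_K : forall a b : M,
    leM (f_box (f_imp a b)) (f_imp (f_box a) (f_box b));
  nc_S3 : forall a b : M,
    leM (f_box (f_imp a b)) (f_box (f_imp (f_box a) (f_box b)));
  nc_all_eqv : forall (A B : form C) (x : nat) (g : nat -> M) (t1 t2 : M -> M),
    x \in fv A -> x \in fv B ->
    definable_by A x g t1 -> definable_by B x g t2 ->
    leM (f_all (fun a => f_eqv (t1 a) (t2 a))) (f_eqv (f_all t1) (f_all t2));
  nc_all_imp : forall (A B : form C) (x : nat) (g : nat -> M) (t1 t2 : M -> M),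
    definable_by A x g t1 -> definable_by B x g t2 ->
    leM (f_all (fun a => f_imp (t1 a) (t2 a))) (f_imp (f_all t1) (f_all t2));
  nc_inst : forall (t : M -> M) (a : M), definable t -> leM (f_all t) (t a);
  nc_all_const : forall (A B : form C) (x : nat) (g : nat -> M) (b : M)
      (t' : M -> M),
    Fm A -> x \notin fv A -> b = den g A -> definable_by B x g t' ->
    leM (f_all (fun a => f_imp b (t' a))) (f_imp b (f_all t'));
  nc_barcan : forall t : M -> M, definable t ->
    eqM (f_box (f_all t)) (f_all (fun a => f_box (t a)));
  nc_all_nec : forall t : M -> M, definable t -> (forall a, NEC M (t a)) ->
    NEC M (f_all t) }.

Definition normal (C : constants) (M : domain C) : Prop := exists a, NEC M a.

Record S3_model (C : constants) (M : domain C) : Prop := {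
  S3_boolean : normal M -> boolean_prealgebra M;
  S3_truth : truth_conditions M;
  S3_filter : normal M -> nec_filter M;
  S3_nec : normal M -> nec_conditions M }.

Definition S4_model (C : constants) (M : domain C) : Prop :=
  [/\ S3_model M, normal M & forall a : M, leM (f_box a) (f_box (f_box a))].

Definition S5_model (C : constants) (M : domain C) : Prop :=
  S4_model M /\
  forall a : M, leM (f_neg (f_box a)) (f_box (f_neg (f_box a))).

Definition model_of (C : constants) (L : system) (M : domain C) : Prop :=
  match L with
  | S3 => S3_model M
  | S4 => S4_model M
  | S5 => S5_model M
  end.

Definition satisfies (C : constants) (M : domain C) (g : nat -> M)
    (A : form C) : Prop := TRUE M (den g A).

Definition entails (C : constants) (L : system) (Phi : set (form C))
    (A : form C) : Prop :=
  forall (M : domain C) (g : nat -> M), model_of L M -> normal M ->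
    (forall B, Phi B -> satisfies g B) -> satisfies g A.

(* Main.v *)
Require Import Defs.
From mathcomp Require Import all_boot.
From mathcomp Require Import boolp classical_sets.
From mathcomp Require Import zify.
From Stdlib Require List.

Set Implicit Arguments.
Unset Strict Implicit.
Unset Printing Implicit Defensive.

Local Open Scope classical_set_scope.

(** Soundness: the axioms denote necessary propositions; for tautologies this
    is Kalmar's lemma in a Boolean prealgebra.

    Completeness is a Henkin construction. The language is extended by
    constants that witness universal formulas and by constants that replace
    the free variables. A formula of the extended language counts as derivable
    if it is derivable in the original one after its new constants are replaced
    by sufficiently large variables, so that nothing is captured and no
    substitution ever renames a bound variable. A maximal theory [T] of
    sentences yields a model on the sentences modulo [T (Eqv A B)]. There,
    [f_all t] is the class of [All x A] if [t] is the meaning of a formula [A]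
    in which [x] is actually free, which is well defined by the axiom
    [sch_eqv_all]; any other definable [t] is constant, and [f_all t] is its
    value. *)

(** * Soundness *)

(** Necessitation applies to axioms only, so the canonical model cannot rest on closing theorems
    under [Box], and no accessibility relation appears. Instead [NEC] collects the classes of those
    [A] with [T (Box A)]; its closure properties are read off from axioms and boxed axioms in [T],
    and under a quantifier the Barcan axiom moves the box inside or outside so that a witness
    applies.

    The constants may form a type of any cardinality, whereas there are only countably many
    variables; a replacement of new constants by variables is therefore not assumed injective.
    Defining derivability through such replacements spares a second calculus and a translation of
    its derivations. The price is that the original free variables come back under shifted names and
    must be restored.

    The delicate operation is [f_all], which acts on functions, while the axioms speak of formulas
    with a bound variable. Representing formulas of one function may differ in that variable, and a
    function given by a formula without it may still be represented by another formula. Hence the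
    renamings to a common variable and the case distinctions on representability. *)

Lemma mem_fresh (s : seq nat) n : fresh s <= n -> n \notin s.
Proof.
move=> le_n; apply/negP => n_s; suff : n <= foldr maxn 0 s by rewrite /fresh in le_n;
  lia.
elim: s n_s {le_n} => //= a s IH; rewrite inE => /orP[/eqP ->|/IH]; lia.
Qed.

Lemma upd_same (T : Type) (g : nat -> T) x a : upd g x a x = a.
Proof. by rewrite /upd eqxx. Qed.

Lemma upd_neq (T : Type) (g : nat -> T) x a y : y != x -> upd g x a y = g y.
Proof. by rewrite /upd => /negPf ->. Qed.

Section Soundness.
Variable C : constants.

(** * Denotation under capture-avoiding substitution *)

Lemma den_eq_fv (M : domain C) (A : form C) (g h : nat -> M) :
  {in fv A, g =1 h} -> den g A = den h A.
Proof.
elim: A g h => [x|c|A IH|A IHA B IHB|A IHA B IHB|A IHA B IHB|A IHA B IHB|A IH|x A IH] g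
  h /= gh.
- by apply: gh; rewrite inE.
- by [].
- by rewrite (IH g h).
1-4: by rewrite (IHA g h) ?(IHB g h) // => v vA; apply: gh; rewrite mem_cat vA ?orbT.
- by rewrite (IH g h).
congr f_all; apply: funext => m; apply: IH => v vA; rewrite /upd; case: eqVneq => // vx.
by apply: gh; rewrite mem_filter vx.
Qed.

Definition avoid (s : nat -> form C) (y : nat) (A : form C) : seq nat :=
  flatten [seq fv (s v) | v <- fv A & v != y].

Definition bname (s : nat -> form C) (y : nat) (A : form C) : nat :=
  if y \in avoid s y A then fresh (avoid s y A) else y.

Lemma msubst_all s y (A : form C) :
  msubst s (All y A) = All (bname s y A) (msubst (upd s y (Var (bname s y A))) A).
Proof. by []. Qed.

Lemma bname_notin s y (A : form C) v :
  v \in fv A -> v != y -> bname s y A \notin fv (s v).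
Proof.
move=> vA vy; have: bname s y A \notin avoid s y A.
  by rewrite /bname; case: ifP => [_|/negbT //]; apply: mem_fresh.
apply: contra => h; apply/flattenP; exists (fv (s v)) => //.
by apply: map_f; rewrite mem_filter vy.
Qed.

(** The induction needs simultaneous substitution, as a binder extends [s] by its own renaming. The
    new bound name is free in no other image, so updating the assignment there leaves the other
    denotations alone. *)
Lemma den_msubst (M : domain C) (A : form C) s (g : nat -> M) :
  den g (msubst s A) = den (fun v => den g (s v)) A.
Proof.
elim: A s g => [x|c|A IH|A IHA B IHB|A IHA B IHB|A IHA B IHB|A IHA B IHB|A IH|x A IH] s
  g;
  rewrite ?msubst_all /= ?IH ?IHA ?IHB //.
congr f_all; apply: funext => m; rewrite IH; apply: den_eq_fv => v vA.
rewrite /upd; case: eqVneq => [_|vx] /=; first by rewrite eqxx.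
apply: den_eq_fv => u uv; case: eqVneq uv => // ->.
by rewrite (negPf (bname_notin _ vA vx)).
Qed.

Lemma den_subst (M : domain C) (A B : form C) x (g : nat -> M) :
  den g (subst A x B) = den (upd g x (den g B)) A.
Proof.
rewrite /subst den_msubst; apply: den_eq_fv => v _.
by rewrite /upd; case: eqVneq.
Qed.

Lemma fv_msubst (A : form C) s u :
  u \in fv (msubst s A) -> exists2 v, v \in fv A & u \in fv (s v).
Proof.
elim: A s => [x|c|A IH|A IHA B IHB|A IHA B IHB|A IHA B IHB|A IHA B IHB|A IH|x A IH] s.
- by exists x => //; rewrite inE.
- by [].
- exact: IH.
1-4: by rewrite /= mem_cat => /orP[/IHA|/IHB] [v vA us]; exists v => //;
  rewrite mem_cat vA ?orbT.
- exact: IH.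
rewrite msubst_all /= mem_filter => /andP[uz /IH [v vA]].
case: (eqVneq v x) => [->|vx]; first by rewrite upd_same inE (negPf uz).
by rewrite upd_neq // => us; exists v => //; rewrite mem_filter vx.
Qed.

(** The substitution axiom supplies well-formedness of the substituted formula, whereas definability
    asks for that of [A]. A renamed binder free in the substituted body can only come from the
    original bound variable, since [bname] avoids all other images. *)
Lemma Fm_msubst_inv (A : form C) s : Fm (msubst s A) -> Fm A.
Proof.
elim: A s => [x|c|A IH|A IHA B IHB|A IHA B IHB|A IHA B IHB|A IHA B IHB|A IH|x A IH] s.
- by [].
- by [].
- exact: IH.
1-4: by move=> [/IHA ? /IHB ?].
- exact: IH.
rewrite msubst_all => -[/fv_msubst [v vA zv] /IH FA]; split => //.
case: (eqVneq v x) => [<- //|vx].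
by move: zv; rewrite upd_neq // (negPf (bname_notin _ vA vx)).
Qed.

Lemma den_alpha (M : domain C) (A B : form C) :
  alpha A B -> forall g : nat -> M, den g A = den g B.
Proof.
elim=> {A B} //=.
- move=> x y A yA g; congr f_all; apply: funext => m; rewrite den_subst /=.
  apply: den_eq_fv => v vA; rewrite upd_same /upd; case: (eqVneq v x) => // vx.
  by case: (eqVneq v y) vA => // ->; rewrite (negPf yA).
- by move=> A B D _ IH1 _ IH2 g; rewrite IH1.
- by move=> A A' _ IH g; rewrite IH.
1-4: by move=> A A' B B' _ IH1 _ IH2 g; rewrite IH1 IH2.
- by move=> A A' _ IH g; rewrite IH.
by move=> x A A' _ IH g; congr f_all; apply: funext => m; rewrite IH.
Qed.

(** * Order reasoning and tautologies in a Boolean prealgebra *)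

Section Boolean.
Variables (M : domain C) (bp : boolean_prealgebra M).
Implicit Types a b c e : M.

Let le_refl a : leM a a := bp_refl bp a.
Let le_trans a b c : leM a b -> leM b c -> leM a c := @bp_trans _ _ bp a b c.

Lemma le_orl a b : leM a (f_or a b).
Proof. by apply/(bp_le bp); apply: (bp_and_or bp). Qed.

Lemma le_orr a b : leM b (f_or a b).
Proof. exact: le_trans (le_orl b a) (proj1 (bp_orC bp _ _)). Qed.

Lemma le_andl a b : leM (f_and a b) a.
Proof. exact: le_trans (le_orr a _) (proj1 (bp_or_and bp _ _)). Qed.

Lemma le_andr a b : leM (f_and a b) b.
Proof. exact: le_trans (proj1 (bp_andC bp _ _)) (le_andl _ _). Qed.

Lemma eqM_trans a b c : eqM a b -> eqM b c -> eqM a c.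
Proof.
by move=> [ab ba] [bc cb]; split; [apply: le_trans ab bc|apply: le_trans cb ba].
Qed.

Lemma le_and a b c : leM c a -> leM c b -> leM c (f_and a b).
Proof.
move=> /(bp_le bp) ca /(bp_le bp) cb; apply/(bp_le bp).
apply: eqM_trans (bp_andA bp _ _ _) _; apply: eqM_trans cb.
by apply: (bp_cong_and bp).
Qed.

Lemma le_top a : leM a (f_top M).
Proof. by apply/(bp_le bp); apply: (bp_top bp). Qed.

Lemma le_bot a : leM (f_bot M) a.
Proof. exact: le_trans (le_orr a _) (proj1 (bp_bot bp _)). Qed.

Lemma le_or a b c : leM a c -> leM b c -> leM (f_or a b) c.
Proof.
move=> /(bp_le bp) ac /(bp_le bp) bc; apply/(bp_le bp).
apply: eqM_trans (bp_andC bp _ _) _; apply: eqM_trans (bp_distr bp _ _ _) _.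
by apply: (bp_cong_or bp); apply: eqM_trans (bp_andC bp _ _) _.
Qed.

Lemma le_distr a b c d :
  leM (f_and a b) d -> leM (f_and a c) d -> leM (f_and a (f_or b c)) d.
Proof.
move=> abd acd; apply: le_trans (proj1 (bp_distr bp _ _ _)) _; exact: le_or.
Qed.

Lemma le_cases x e b : leM (f_and e x) b -> leM (f_and e (f_neg x)) b -> leM e b.
Proof.
move=> ex enx; apply: le_trans (le_distr ex enx); apply: le_and => //.
exact: le_trans (le_top e) (proj2 (bp_or_neg bp x)).
Qed.

Lemma le_contra x e b : leM e x -> leM e (f_neg x) -> leM e b.
Proof.
move=> ex enx; apply: le_trans (le_and ex enx) _.
exact: le_trans (proj1 (bp_and_neg bp _)) (le_bot _).
Qed.

Lemma le_neg x e : leM (f_and e x) (f_bot M) -> leM e (f_neg x).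
Proof.
by move=> h; apply: (@le_cases x); [apply: le_trans h (le_bot _)|apply: le_andr].
Qed.

Lemma le_mp a b e : leM e (f_imp a b) -> leM e a -> leM e b.
Proof.
move=> eab ea; apply: le_trans (le_and ea (le_trans eab (proj1 (bp_imp bp _ _)))) _.
apply: le_distr; last exact: le_andr.
exact: le_contra (le_andl _ _) (le_andr _ _).
Qed.

Definition literal (v : bool) a : M := if v then a else f_neg a.

Fixpoint pdenote (s : nat -> M) (p : pform) : M :=
  match p with
  | PVar n => s n
  | PTop => f_top M
  | PBot => f_bot M
  | PNeg p => f_neg (pdenote s p)
  | PImp p q => f_imp (pdenote s p) (pdenote s q)
  | POr p q => f_or (pdenote s p) (pdenote s q)
  | PAnd p q => f_and (pdenote s p) (pdenote s q)
  end.

Fixpoint pbound (p : pform) : nat :=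
  match p with
  | PVar n => n.+1
  | PTop | PBot => 0
  | PNeg p => pbound p
  | PImp p q | POr p q | PAnd p q => maxn (pbound p) (pbound q)
  end.

(* Kalmar's lemma. *)
Lemma le_literal s v p e :
  (forall i, i < pbound p -> leM e (literal (v i) (s i))) ->
  leM e (literal (peval v p) (pdenote s p)).
Proof.
elim: p => [n|||p IH|p IHp q IHq|p IHp q IHq|p IHp q IHq] /= h.
- exact: h.
- exact: le_top.
- by apply: le_neg; apply: le_andr.
- move: (IH h); case: (peval v p) => //= ep.
  apply: le_neg; apply: (le_contra (x := pdenote s p)); last exact: le_andr.
  exact: le_trans (le_andl _ _) ep.
- have {IHp} := IHp (fun i hi => h i ltac:(lia)).
  have {IHq} := IHq (fun i hi => h i ltac:(lia)).
  case: (peval v q) => /= eq; case: (peval v p) => /= ep.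
  + exact: le_trans (le_trans eq (le_orr _ _)) (proj2 (bp_imp bp _ _)).
  + exact: le_trans (le_trans eq (le_orr _ _)) (proj2 (bp_imp bp _ _)).
  + apply: le_neg; apply: (le_contra (x := pdenote s q)).
      by apply: (le_mp (le_andr _ _)); apply: le_trans (le_andl _ _) ep.
    exact: le_trans (le_andl _ _) eq.
  + exact: le_trans (le_trans ep (le_orl _ _)) (proj2 (bp_imp bp _ _)).
- have {IHp} := IHp (fun i hi => h i ltac:(lia)).
  have {IHq} := IHq (fun i hi => h i ltac:(lia)).
  case: (peval v p) => /= eq ep; first exact: le_trans ep (le_orl _ _).
  case: (peval v q) eq => /= eq; first exact: le_trans eq (le_orr _ _).
  apply: le_neg; apply: le_distr.
    exact: le_contra (le_andr _ _) (le_trans (le_andl _ _) ep).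
  exact: le_contra (le_andr _ _) (le_trans (le_andl _ _) eq).
have {IHp} := IHp (fun i hi => h i ltac:(lia)).
have {IHq} := IHq (fun i hi => h i ltac:(lia)).
case: (peval v p) => /= eq ep; last first.
  apply: le_neg; apply: (le_contra (x := pdenote s p)).
    exact: le_trans (le_andr _ _) (le_andl _ _).
  exact: le_trans (le_andl _ _) ep.
case: (peval v q) eq => /= eq; first exact: le_and.
apply: le_neg; apply: (le_contra (x := pdenote s q)).
  exact: le_trans (le_andr _ _) (le_andr _ _).
exact: le_trans (le_andl _ _) eq.
Qed.

Lemma le_tautology s p e : tautology p -> leM e (pdenote s p).
Proof.
(* Literals are assumed from index [n] on and discharged one at a time by excluded middle in the
   algebra: at [n = 0] Kalmar's lemma applies, at the bound nothing is assumed. *)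
move=> taut; suff H n v e' : (forall i, n <= i < pbound p -> leM e' (literal (v i) (s
  i))) ->
    leM e' (pdenote s p).
  by apply: (H (pbound p) xpredT) => i /andP[]; lia.
elim: n v e' => [|n IH] v e' h.
  by have := le_literal (v := v) (fun i hi => h i hi); rewrite taut.
have step (b : bool) : leM (f_and e' (literal b (s n))) (pdenote s p).
  apply: (IH (upd v n b)) => i hi; case: (eqVneq i n) => [->|ni].
    by rewrite upd_same; apply: le_andr.
  have lt_i : n < i < pbound p by move/eqP: ni; lia.
  by rewrite upd_neq //; apply: le_trans (le_andl _ _) (h i lt_i).
exact: le_cases (step true) (step false).
Qed.

End Boolean.

Lemma den_pinst (M : domain C) (g : nat -> M) s p :
  den g (pinst s p) = pdenote (fun i => den g (s i)) p.
Proof.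
by elim: p => //= [||p ->|p -> q ->|p -> q ->|p -> q ->] //;
  rewrite ?Gamma_bot ?Gamma_top.
Qed.

(** * Necessity of the axioms *)

Lemma model_of_S3 L (M : domain C) : model_of L M -> S3_model M.
Proof. by case: L => //= [[]|[[]]]. Qed.

Lemma schema_NEC L (M : domain C) (g : nat -> M) (A : form C) :
  model_of L M -> normal M -> Fm A -> schema L A -> NEC M (den g A).
Proof.
move=> hM nM; have h3 := model_of_S3 hM.
have bp := S3_boolean h3 nM; have nf := S3_filter h3 nM; have nc := S3_nec h3 nM.
have definableP B x : Fm B -> definable (fun m => den (upd g x m) B).
  by move=> FB; exists B, x, g.
(* Normality enters here: some [b] is necessary and lies below top, so top and everything above it
   is necessary. *)
have from_top a : leM (f_top M) a -> NEC M a.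
  case: (nM) => b Nb; apply: (nf_up nf); exact: (nf_up nf Nb (le_top bp b)).
move=> FA sA; case: sA FA => {A}.
- move=> p s taut _; apply: from_top; rewrite den_pinst; exact: le_tautology.
- by move=> A _; apply: (nc_T nc).
- by move=> A B _; apply: (nc_K nc).
- by move=> A B _; apply: (nc_S3 nc).
- move=> A B /(@den_alpha M) AB _; apply: from_top; rewrite /= (AB g).
  exact: (nc_eqv_refl nc).
- by move=> A B _; apply: (nc_eqv_imp nc).
- move=> A x B B' xA [_ [FA _]]; rewrite /= !den_subst.
  apply: (nc_eqv_subst nc (t := fun m => den (upd g x m) A)).
  by apply: definableP; apply: Fm_msubst_inv FA.
- move=> x A B [_ [[xA FA] [xB FB]]]; exact: (nc_all_eqv nc xA xB (g := g)).
- move=> x A B [[xA FA] _]; rewrite /= den_subst.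
  by apply: (nc_inst nc (t := fun m => den (upd g x m) A)); apply: definableP.
- move=> x A B [_ [[xA FA] [xB FB]]]; exact: (nc_all_imp nc (A := A) (B := B) (x := x)
    (g := g)).
- move=> x A B xA [_ [FA [xB FB]]] /=.
  have -> : (fun m => f_imp (den (upd g x m) A) (den (upd g x m) B)) =
            (fun m => f_imp (den g A) (den (upd g x m) B)).
    apply: funext => m; congr f_imp; apply: den_eq_fv => v vA; rewrite upd_neq //.
    by apply: contraNneq xA => <-.
  by apply: (nc_all_const nc FA xA (g := g) (B := B)).
- move=> x A [[xA FA] _] /=.
  by case: (nc_barcan nc (definableP A x FA)).
- move=> x A [_ [xA FA]] /=.
  by case: (nc_barcan nc (definableP A x FA)).
- by move=> A L3 _; case: L hM L3 => /= [_ /(_ erefl)|[_ _ h4] _|[[_ _ h4] _] _] //;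
    apply: h4.
- by move=> A L5 _; move: hM; rewrite L5 => -[_ h5]; apply: h5.
Qed.

(** Well-formedness is carried along because [nc_all_nec] speaks of definable functions, and all
    assignments because closure under [All] varies one of them. *)
Lemma axiom_NEC L (M : domain C) (A : form C) :
  model_of L M -> normal M -> Defs.axiom L A ->
  Fm A /\ forall g : nat -> M, NEC M (den g A).
Proof.
move=> hM nM; elim=> {A} [A FA sA|x A xA _ [FA IH]].
  by split=> // g; apply: schema_NEC sA.
split=> // g; apply: (nc_all_nec (S3_nec (model_of_S3 hM) nM)) => //.
by exists A, x, g.
Qed.

(** Axiom necessitation preserves truth because axioms lie in [NEC], not merely in [TRUE]. *)
Lemma soundness L (Phi : set (form C)) (A : form C) :
  derives L Phi A -> entails L Phi A.
Proof.
move=> dA M g hM nM; have h3 := model_of_S3 hM.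
have tc := S3_truth h3; have nf := S3_filter h3 nM.
move=> hPhi; elim: dA => {A} [A /hPhi //|A aA|A B _ IHA _ IHAB|A aA];
  rewrite /satisfies.
- apply: (nf_true nf); exact: (proj2 (axiom_NEC hM nM aA)).
- by move/(tc_imp tc): IHAB; apply.
- by apply/(tc_box tc); exact: (proj2 (axiom_NEC hM nM aA)).
Qed.

End Soundness.

(** * Literal substitution *)

Fixpoint bv (C : constants) (A : form C) : seq nat :=
  match A with
  | Var _ | Cst _ => [::]
  | Neg A | Box A => bv A
  | Imp A B | Or A B | And A B | Eqv A B => bv A ++ bv B
  | All x A => x :: bv A
  end.

Fixpoint occ (C : constants) (c : C) (A : form C) : Prop :=
  match A with
  | Var _ => False
  | Cst d => d = c
  | Neg A | Box A | All _ A => occ c A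
  | Imp A B | Or A B | And A B | Eqv A B => occ c A \/ occ c B
  end.

(* Replaces constants and free variables without renaming bound variables;
   the result is meaningful only under [no_capture]. *)
Fixpoint lsubst (C D : constants) (th : C -> form D) (s : nat -> form D)
    (A : form C) : form D :=
  match A with
  | Var x => s x
  | Cst c => th c
  | Neg A => Neg (lsubst th s A)
  | Imp A B => Imp (lsubst th s A) (lsubst th s B)
  | Or A B => Or (lsubst th s A) (lsubst th s B)
  | And A B => And (lsubst th s A) (lsubst th s B)
  | Eqv A B => Eqv (lsubst th s A) (lsubst th s B)
  | Box A => Box (lsubst th s A)
  | All x A => All x (lsubst th (upd s x (Var x)) A)
  end.

Fixpoint no_capture (C D : constants) (th : C -> form D) (s : nat -> form D)
    (A : form C) : Prop :=
  match A with
  | Var _ | Cst _ => True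
  | Neg A | Box A => no_capture th s A
  | Imp A B | Or A B | And A B | Eqv A B => no_capture th s A /\ no_capture th s B
  | All x A =>
      [/\ forall v, v \in fv A -> v != x -> x \notin fv (s v),
          forall c, occ c A -> x \notin fv (th c) &
          no_capture th (upd s x (Var x)) A]
  end.

Definition lsubst1 (C : constants) (A : form C) (x : nat) (B : form C) : form C :=
  lsubst Cst (upd Var x B) A.

Section LSubst.
Variables (C D : constants).
Implicit Types (A B : form C) (th : C -> form D) (s : nat -> form D).

Lemma eq_lsubst A th th' s s' :
  (forall c, occ c A -> th c = th' c) -> {in fv A, s =1 s'} ->
  lsubst th s A = lsubst th' s' A.
Proof.
elim: A s s' => [x|c|A IH|A IHA B IHB|A IHA B IHB|A IHA B IHB|A IHA B IHB|A IH|x A IH]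
  s s' /= eth es.
- by apply: es; rewrite inE.
- exact: eth.
- by rewrite (IH s s').
1-4: by rewrite (IHA s s') ?(IHB s s') // => v vA; [apply: eth; right|
  apply: es; rewrite mem_cat vA orbT|apply: eth; left|apply: es; rewrite mem_cat vA].
- by rewrite (IH s s').
congr All; apply: IH => // v vA; rewrite /upd; case: eqVneq => // vx.
by apply: es; rewrite mem_filter vx.
Qed.

Lemma fv_lsubst A th s u : u \in fv (lsubst th s A) ->
  (exists2 v, v \in fv A & u \in fv (s v)) \/ (exists2 c, occ c A & u \in fv (th c)).
Proof.
elim: A s => [x|c|A IH|A IHA B IHB|A IHA B IHB|A IHA B IHB|A IHA B IHB|A IH|x A IH] s
  /=.
- by left; exists x => //; rewrite inE.
- by right; exists c.
- exact: IH.
1-4: rewrite mem_cat => /orP[/IHA|/IHB] [[v vA us]|[c cA uc]];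
  [left; exists v; rewrite ?mem_cat ?vA ?orbT //|right; exists c; auto|
   left; exists v; rewrite ?mem_cat ?vA ?orbT //|right; exists c; auto].
- exact: IH.
rewrite mem_filter => /andP[ux /IH [[v vA]|]]; last by right.
case: (eqVneq v x) => [->|vx]; first by rewrite upd_same inE (negPf ux).
by rewrite upd_neq // => us; left; exists v => //; rewrite mem_filter vx.
Qed.

Lemma fv_lsubst_var A th s y :
  s y = Var y -> y \in fv A -> y \in fv (lsubst th s A).
Proof.
elim: A s => [x|c|A IH|A IHA B IHB|A IHA B IHB|A IHA B IHB|A IHA B IHB|A IH|x A IH] s
  //= sy.
- by rewrite inE => /eqP <-; rewrite sy inE.
- exact: IH.
1-4: by rewrite !mem_cat => /orP[/IHA|/IHB] -> //; rewrite orbT.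
- exact: IH.
rewrite !mem_filter => /andP[yx yA]; rewrite yx /=; apply: IH => //.
by rewrite upd_neq.
Qed.

Lemma Fm_lsubst A th s : Fm A -> (forall c, Fm (th c)) -> (forall v, Fm (s v)) ->
  Fm (lsubst th s A).
Proof.
elim: A s => [x|c|A IH|A IHA B IHB|A IHA B IHB|A IHA B IHB|A IHA B IHB|A IH|x A IH] s
  //=.
- by move=> *; apply: IH.
1-4: by move=> [FA FB] *; split; [apply: IHA|apply: IHB].
- by move=> *; apply: IH.
move=> [xA FA] Fth Fs; split; first by apply: fv_lsubst_var => //; rewrite upd_same.
by apply: IH => // v; rewrite /upd; case: eqP.
Qed.

Lemma occ_lsubst A th s d : occ d (lsubst th s A) ->
  (exists v, occ d (s v)) \/ (exists2 c, occ c A & occ d (th c)).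
Proof.
elim: A s => [x|c|A IH|A IHA B IHB|A IHA B IHB|A IHA B IHB|A IHA B IHB|A IH|x A IH] s
  /=.
- by left; exists x.
- by right; exists c.
- exact: IH.
1-4: by move=> [/IHA|/IHB] [|[c cA dc]]; auto; right; exists c; auto.
- exact: IH.
by move=> /IH [[v]|]; auto; rewrite /upd; case: eqP => //= _; left; exists v.
Qed.

(** Sending a variable to itself is harmless even if it is also bound in [A]: its own binder ignores
    it and any other binder differs from it. *)
Lemma no_capture_bv A th s :
  (forall v, s v = Var v \/ {in bv A, forall y, y \notin fv (s v)}) ->
  (forall c, {in bv A, forall y, y \notin fv (th c)}) -> no_capture th s A.
Proof.
elim: A s => [x|c|A IH|A IHA B IHB|A IHA B IHB|A IHA B IHB|A IHA B IHB|A IH|x A IH] s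
  //= hs hth.
- exact: IH.
1-4: by split; [apply: IHA => [v|c y yA]|apply: IHB => [v|c y yA]];
  do [by apply: hth; rewrite mem_cat yA ?orbT|case: (hs v) => [|hv]; [by left|]];
  right=> y yA; apply: hv; rewrite mem_cat yA ?orbT.
- exact: IH.
split=> [v vA vx|c _|].
- case: (hs v) => [->|]; first by rewrite inE eq_sym.
  by apply; rewrite inE eqxx.
- by apply: hth; rewrite inE eqxx.
apply: IH => [v|c y yA]; last by apply: hth; rewrite inE yA orbT.
rewrite /upd; case: eqP => [->|_]; first by left.
by case: (hs v) => [|hv]; [left|right=> y yA; apply: hv; rewrite inE yA orbT].
Qed.

End LSubst.

Lemma lsubst_id (C : constants) (A : form C) s :
  {in fv A, s =1 Var} -> lsubst Cst s A = A.
Proof.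
elim: A s => [x|c|A IH|A IHA B IHB|A IHA B IHB|A IHA B IHB|A IHA B IHB|A IH|x A IH] s
  /= es.
- by apply: es; rewrite inE.
- by [].
- by rewrite IH.
1-4: by rewrite IHA ?IHB // => v vA; apply: es; rewrite mem_cat vA ?orbT.
- by rewrite IH.
rewrite IH // => v vA; rewrite /upd; case: eqP => [->//|/eqP vx].
by apply: es; rewrite mem_filter vx.
Qed.

Lemma lsubst1_notin (C : constants) (A B : form C) x :
  x \notin fv A -> lsubst1 A x B = A.
Proof.
by move=> xA; apply: lsubst_id => v vA; rewrite upd_neq //; apply: contraNneq xA => <-.
Qed.

(** The first clause of [no_capture] says that the renaming test of [msubst] fails at each
    binder. *)
Lemma msubst_lsubst (C : constants) (A : form C) s :
  no_capture Cst s A -> msubst s A = lsubst Cst s A.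
Proof.
elim: A s => [x|c|A IH|A IHA B IHB|A IHA B IHB|A IHA B IHB|A IHA B IHB|A IH|x A IH] s
  //=.
- by move=> /IH ->.
1-4: by move=> [/IHA -> /IHB ->].
- by move=> /IH ->.
move=> [hv _ /IH {IH}IH]; case: ifP => [/flattenP [l /mapP [v]]|]; last by rewrite IH.
by rewrite mem_filter => /andP[vx /hv /(_ vx) /negPf xv] ->; rewrite xv.
Qed.

(** The law is an equality of formulas rather than an alpha-congruence, because binders stay fixed.
    Only the inner substitution must be free of capture: whatever the outer one captures is captured
    on both sides alike. *)
Lemma lsubst_comp (B C D : constants) (A : form B) (th' : B -> form C) (th : C -> form
  D) s' s :
  no_capture th' s' A ->
  lsubst th s (lsubst th' s' A) =
  lsubst (fun c => lsubst th s (th' c)) (fun v => lsubst th s (s' v)) A.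
Proof.
elim: A s s' => [x|c|A IH|A IHA E IHE|A IHA E IHE|A IHA E IHE|A IHA E IHE|A IH|x A IH]
  s s' //=.
- by move=> /IH ->.
1-4: by move=> [/IHA -> /IHE ->].
- by move=> /IH ->.
move=> [hv hc /IH ->]; congr All; apply: eq_lsubst => [c /hc xc|v vA].
  apply: eq_lsubst => // u uc; rewrite upd_neq //; by apply: contraNneq xc => <-.
rewrite /upd; case: eqVneq => [_|vx] /=; first by rewrite eqxx.
apply: eq_lsubst => // u uv; case: eqVneq uv => // ->.
by rewrite (negPf (hv v vA vx)).
Qed.

Lemma eq_no_capture (C D : constants) (A : form C) (th : C -> form D) s s' :
  {in fv A, s =1 s'} -> no_capture th s A -> no_capture th s' A.
Proof.
elim: A s s' => [x|c|A IH|A IHA B IHB|A IHA B IHB|A IHA B IHB|A IHA B IHB|A IH|x A IH]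
  s s' //= es.
- exact: IH.
1-4: by move=> [hA hB]; split; [apply: IHA hA|apply: IHB hB] => v vA; apply: es;
  rewrite mem_cat vA ?orbT.
- exact: IH.
move=> [hv hc hA]; split=> // [v vA vx|].
  by rewrite -es ?hv // mem_filter vx.
apply: IH hA => v vA; rewrite /upd; case: eqVneq => // vx.
by apply: es; rewrite mem_filter vx.
Qed.

Lemma no_capture_comp (C : constants) (A : form C) s' s :
  (forall v, exists w, s' v = Var w) -> no_capture Cst s' A ->
  no_capture Cst (fun v => lsubst Cst s (s' v)) A ->
  no_capture Cst s (lsubst Cst s' A).
Proof.
elim: A s s' => [x|c|A IH|A IHA B IHB|A IHA B IHB|A IHA B IHB|A IHA B IHB|A IH|x A IH]
  s s' //= vs.
- by move: (vs x) => [w ->].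
- exact: IH.
1-4: by move=> [? ?] [? ?]; split; [apply: IHA|apply: IHB].
- exact: IH.
move=> [hv' _ hA'] [hv _ hA]; split=> // [u /fv_lsubst [[v vA]|[]//]|].
- case: (eqVneq v x) => [->|vx]; first by rewrite upd_same inE => ->.
  rewrite upd_neq //; have := hv v vA vx.
  by case: (vs v) => w -> /= hw; rewrite inE => /eqP ->.
apply: IH => //.
  by move=> v; rewrite /upd; case: eqP => // _; exists x.
apply: eq_no_capture hA => v vA; rewrite /upd; case: eqVneq => [_|vx] /=;
  first by rewrite eqxx.
apply: eq_lsubst => // u; case: eqVneq => // -> xv.
by move: (hv' v vA vx); rewrite xv.
Qed.

(** * Derivations *)

Section Derivations.
Variables (C : constants) (L : system).
Implicit Types (Phi : set (form C)) (A B : form C).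

Lemma axiom_Fm A : Defs.axiom L A -> Fm A.
Proof. by elim=> {A} //= x A xA _ FA. Qed.

Lemma derives_Fm Phi A :
  (forall B, Phi B -> Fm B) -> derives L Phi A -> Fm A.
Proof.
move=> FPhi; elim=> {A} [//|A /axiom_Fm //|A B _ _ _ [] //|A /axiom_Fm //].
Qed.

Lemma derives_sub Phi Psi A :
  (forall B, Phi B -> Psi B) -> derives L Phi A -> derives L Psi A.
Proof.
move=> sub; elim=> {A} [A /sub|A|A B _ dA _|A]; first exact: derives_hyp.
- exact: derives_axiom.
- exact: derives_mp.
- exact: derives_nec.
Qed.

Lemma derives_taut Phi p s : tautology p -> Fm (pinst s p) -> derives L Phi (pinst s p).
Proof. by move=> tp Fp; apply/derives_axiom/axiom_schema => //; apply: sch_taut. Qed.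

Arguments derives_taut {Phi p s} _ _.

Lemma derives_schema Phi A : Fm A -> schema L A -> derives L Phi A.
Proof. by move=> FA sA; apply/derives_axiom/axiom_schema. Qed.

Lemma derives_weaken Phi A B : Fm A -> Fm B -> derives L Phi B -> derives L Phi (Imp A
  B).
Proof.
move=> FA FB dB; apply: derives_mp dB _.
by apply: (derives_taut (p := PImp (PVar 0) (PImp (PVar 1) (PVar 0)))
  (s := nth A [:: B; A])) => // v /=; case: (v 0); case: (v 1).
Qed.

(** Necessitation does not obstruct the deduction theorem: it applies to axioms only, so the boxed
    formula it yields never depends on [A]. *)
Lemma deduction Phi A B : Fm A -> (forall D, Phi D -> Fm D) ->
  derives L (fun D => D = A \/ Phi D) B -> derives L Phi (Imp A B).
Proof.
move=> FA FPhi; have FPsi D : (D = A \/ Phi D) -> Fm D by case=> [->//|/FPhi].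
elim=> {B} [B [->|PB]|B aB|B D dB IHB dBD IHBD|B aB].
- by apply: (derives_taut (p := PImp (PVar 0) (PVar 0)) (s := fun=> A)) => // v /=;
    case: (v 0).
- by apply: derives_weaken => //; [apply: FPhi|apply: derives_hyp].
- by apply: derives_weaken => //; [apply: axiom_Fm|apply: derives_axiom].
- have [FB FD] := derives_Fm FPsi dBD.
  apply: derives_mp IHB _; apply: derives_mp IHBD _.
  by apply: (derives_taut (p := PImp (PImp (PVar 0) (PImp (PVar 1) (PVar 2)))
      (PImp (PImp (PVar 0) (PVar 1)) (PImp (PVar 0) (PVar 2))))
    (s := nth A [:: A; B; D])) => // v /=; case: (v 0); case: (v 1); case: (v 2).
- apply: derives_weaken => //; last exact: derives_nec.
  exact: axiom_Fm aB.
Qed.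

(** Vacuous quantifiers are not formulas, hence the premise that [z] is free in the conclusion. In
    modus ponens the minor premise may lack [z]; then [sch_all_const] takes the place of
    [sch_all_imp]. A necessitated axiom is generalised under the box, and the converse Barcan axiom
    moves the quantifier out. *)
Lemma generalization Phi z A : (forall B, Phi B -> Fm B) ->
  (forall B, Phi B -> z \notin fv B) -> derives L Phi A -> z \in fv A ->
  derives L Phi (All z A).
Proof.
move=> FPhi zPhi; elim=> {A} [A /zPhi /negPf -> //|A aA zA|A B dA IHA dAB IHAB zB|A aA
  zA].
- by apply/derives_axiom/axiom_all.
- have [FA FB] := derives_Fm FPhi dAB.
  have {}IHAB : derives L Phi (All z (Imp A B)) by apply: IHAB; rewrite mem_cat zB orbT.
  have zAB : z \in fv A ++ fv B by rewrite mem_cat zB orbT.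
  case: (boolP (z \in fv A)) => zA.
    apply: derives_mp (IHA zA) _; apply: derives_mp IHAB _.
    by apply: derives_schema; [|apply: sch_all_imp].
  apply: derives_mp dA _; apply: derives_mp IHAB _.
  by apply: derives_schema; [|apply: sch_all_const].
- have FA := axiom_Fm aA.
  have aAll : Defs.axiom L (All z A) by apply: axiom_all.
  apply: derives_mp (derives_nec Phi aAll) _.
  by apply: derives_schema; [|apply: sch_cbarcan].
Qed.

(* Generalise over the new name [z] and instantiate it with [x]. *)
Lemma derives_rename A s x z : Fm A -> (forall v, exists w, s v = Var w) ->
  x \in fv A -> s x = Var z -> (forall v, s v = Var z -> v = x) ->
  no_capture Cst s A -> no_capture Cst (upd s x (Var x)) A ->
  derives L set0 (lsubst Cst s A) -> derives L set0 (lsubst Cst (upd s x (Var x)) A).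
Proof.
move=> FA vs xA sx sz nc nc' d.
have Fs : Fm (lsubst Cst s A) by apply: Fm_lsubst => // v; case: (vs v) => w ->.
have es v : lsubst Cst (upd Var z (Var x)) (s v) = upd s x (Var x) v.
  have [w sv] := vs v; rewrite sv /= /upd; case: (eqVneq v x) => [vx|].
    by move: sv; rewrite vx sx => -[->]; rewrite eqxx.
  by case: (eqVneq w z) sv => // -> /sz ->; rewrite eqxx.
have E : subst (lsubst Cst s A) z (Var x) = lsubst Cst (upd s x (Var x)) A.
  rewrite /subst msubst_lsubst; first by rewrite lsubst_comp //; apply: eq_lsubst.
  by apply: no_capture_comp => //; apply: eq_no_capture nc' => v _; rewrite es.
case: (boolP (z \in fv (lsubst Cst s A))) => zA; last first.
  rewrite -E /subst msubst_lsubst ?(@lsubst_id _ _ (upd Var z (Var x))) //.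
    by move=> v vA; rewrite upd_neq //; apply: contraNneq zA => <-.
  by apply: no_capture_comp => //; apply: eq_no_capture nc' => v _; rewrite es.
rewrite -E; apply: derives_mp (generalization (z := z) _ _ d zA) _ => //.
apply: derives_schema; last exact: sch_inst.
split=> //; rewrite E; apply: Fm_lsubst => // v.
by rewrite /upd; case: eqP => // _; case: (vs v) => w ->.
Qed.

(** Generalisation and instantiation rename one variable at a time, so the shift is undone from
    variable 0 upwards. The offset [n] exceeds all variables of [A], so restored and shifted names
    never meet. *)
Lemma derives_shift A n : Fm A -> fresh (fv A ++ bv A) <= n ->
  derives L set0 (lsubst Cst (fun v => Var (v + n)) A) -> derives L set0 A.
Proof.
move=> FA le_n d.
(* Variables below [m] are restored, the others still shifted; [s n] is the identity on the free
   variables of [A]. *)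
pose s m v : form C := if v < m then Var v else Var (v + n).
have vs m v : exists w, s m v = Var w by rewrite /s; case: ifP;
  [exists v|exists (v + n)].
have nc m : no_capture Cst (s m) A.
  apply: no_capture_bv => // v; rewrite /s; case: ifP => _; [by left|right=> y yA].
  rewrite inE; apply: contraL yA => /eqP ->.
  have := @mem_fresh (fv A ++ bv A) (v + n) ltac:(lia).
  by rewrite mem_cat negb_or => /andP[].
have step m : m <= n -> derives L set0 (lsubst Cst (s m) A).
  elim: m => [_|m IH lt_m]; first exact: d.
  have e v : s m.+1 v = upd (s m) m (Var m) v.
    rewrite /s /upd; case: (eqVneq v m) => [->|]; first by rewrite ltnSn.
    by move=> /eqP vm; rewrite ltnS leq_eqVlt; case: eqP vm.
  have es : lsubst Cst (s m.+1) A = lsubst Cst (upd (s m) m (Var m)) A.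
    by apply: eq_lsubst => v _; rewrite ?e.
  have {}IH := IH (ltnW lt_m).
  case: (boolP (m \in fv A)) => mA.
    rewrite es; apply: (derives_rename (z := m + n)) => //.
    + by rewrite /s ltnn.
    + by move=> v; rewrite /s; case: ifP => lt_v [?]; lia.
    + by apply: eq_no_capture (nc m.+1) => v _; rewrite e.
  suff -> : lsubst Cst (s m.+1) A = lsubst Cst (s m) A by [].
  rewrite es; apply: eq_lsubst => // v vA; rewrite upd_neq //.
  by apply: contraNneq mA => <-.
have := step n (leqnn n); rewrite lsubst_id // => v vA; rewrite /s ifT //.
rewrite ltnNge; apply/negP => le_v; have := mem_fresh (leq_trans le_n le_v).
by rewrite mem_cat vA.
Qed.

End Derivations.

Arguments derives_taut {C L Phi p s} _ _.
Arguments derives_schema {C L Phi A} _ _.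

Lemma fresh_sub (s t : seq nat) : {subset s <= t} -> fresh s <= fresh t.
Proof.
rewrite {1}/fresh; elim: s => //= a s IH sub.
have at_ : a < fresh t by rewrite ltnNge; apply/negP => /mem_fresh;
  rewrite sub ?inE ?eqxx.
have := IH (fun y ys => sub y (mem_behead (s := a :: s) ys)); lia.
Qed.

Lemma In_flatten (T : Type) (U : eqType) (f : T -> seq U) (l : seq T) t u :
  List.In t l -> u \in f t -> u \in flatten [seq f x | x <- l].
Proof.
by elim: l => //= t' l IH [->|/IH h] ut; rewrite mem_cat ?ut ?h ?orbT.
Qed.

Lemma fv_lsubst_mem (C D : constants) (A : form C) (th : C -> form D) s u v :
  no_capture th s A -> v \in fv A -> u \in fv (s v) -> u \in fv (lsubst th s A).
Proof.
elim: A s => [x|c|A IH|A IHA B IHB|A IHA B IHB|A IHA B IHB|A IHA B IHB|A IH|x A IH] s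
  //=.
- by move=> _; rewrite inE => /eqP ->.
- exact: IH.
1-4: by move=> [hA hB]; rewrite !mem_cat => /orP[vA|vB] us;
  rewrite ?(IHA _ hA vA us) // (IHB _ hB vB us) orbT.
- exact: IH.
move=> [hv _ hA]; rewrite !mem_filter => /andP[vx vA] us; apply/andP; split.
  by apply: contraNneq (hv v vA vx) => <-.
by apply: IH hA vA _; rewrite upd_neq.
Qed.

(** * Henkin constants *)

(* [henkin_const] contains a copy of the syntax of the formulas over
   [C + henkin_const]; the code of [All x A] serves as the witness of
   [All x A], and [KVar v] also stands for the free variable [v]. *)
Inductive henkin_const (C : Type) : Type :=
| KVar of nat
| KCst of C
| KNew of henkin_const C
| KNeg of henkin_const C
| KImp of henkin_const C & henkin_const C
| KOr of henkin_const C & henkin_const C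
| KAnd of henkin_const C & henkin_const C
| KEqv of henkin_const C & henkin_const C
| KBox of henkin_const C
| KAll of nat & henkin_const C.

Arguments KVar {C} _.

Fixpoint ksize (C : Type) (k : henkin_const C) : nat :=
  match k with
  | KVar _ | KCst _ => 0
  | KNew k | KNeg k | KBox k | KAll _ k => (ksize k).+1
  | KImp k l | KOr k l | KAnd k l | KEqv k l => (ksize k + ksize l).+1
  end.

Definition henkin_constants (C : constants) : constants :=
  @Constants (C + henkin_const C)%type (inl (ctop C)) (inl (cbot C))
    (fun e => ctop_neq_cbot (f_equal
       (fun c : C + henkin_const C => if c is inl d then d else ctop C) e)).

Fixpoint code (C : constants) (A : form (henkin_constants C)) : henkin_const C :=
  match A with
  | Var x => KVar x
  | Cst (inl c) => KCst c
  | Cst (inr k) => KNew k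
  | Neg A => KNeg (code A)
  | Imp A B => KImp (code A) (code B)
  | Or A B => KOr (code A) (code B)
  | And A B => KAnd (code A) (code B)
  | Eqv A B => KEqv (code A) (code B)
  | Box A => KBox (code A)
  | All x A => KAll x (code A)
  end.

Definition sentence (C : constants) (A : form C) : Prop := Fm A /\ fv A = [::].

Section Henkin.
Variables (C : constants) (L : system).
Local Notation K := (henkin_const C).
Local Notation HC := (henkin_constants C).
Local Notation HForm := (form HC).

Lemma code_inj : injective (@code C).
Proof.
elim=> [x|[c|k]|A IH|A IHA B IHB|A IHA B IHB|A IHA B IHB|A IHA B IHB|A IH|x A IH]
  [y|[d|l]|A'|A' B'|A' B'|A' B'|A' B'|A'|y A'] //= [].
1-3: by move=> ->.
- by move=> /IH ->.
1-4: by move=> /IHA -> /IHB ->.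
- by move=> /IH ->.
by move=> -> /IH ->.
Qed.

(** [KNew] makes the code of a constant larger than the constant. Hence the witness of [All x A],
    being larger than the code of [A], does not occur in [A]. *)
Lemma ksize_occ (k : K) (A : HForm) : occ (inr k : HC) A -> ksize k < ksize (code A).
Proof.
elim: A => [x|[c|l]|A IH|A IHA B IHB|A IHA B IHB|A IHA B IHB|A IHA B IHB|A IH|x A IH]
  //=.
- by case=> ->.
- by move=> /IH; lia.
1-4: by case=> [/IHA|/IHB]; lia.
- by move=> /IH; lia.
- by move=> /IH; lia.
Qed.

(** * Replacing Henkin constants by variables *)

Definition var_of_cst (rho : K -> nat) (c : HC) : form C :=
  match c with inl d => Cst d | inr k => Var (rho k) end.

Definition unhenkin (rho : K -> nat) : HForm -> form C := lsubst (var_of_cst rho) Var.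

Definition henkin_var (v : nat) : HForm := Cst (inr (KVar v) : HC).

Definition embed (s : nat -> HForm) : form C -> HForm :=
  lsubst (fun c => Cst (inl c : HC)) s.

Definition witness (x : nat) (A : HForm) : HForm := Cst (inr (KAll x (code A)) : HC).

Definition henkin_axiom (x : nat) (A : HForm) : HForm :=
  Imp (lsubst1 A x (witness x A)) (All x A).

Definition high (n : nat) (rho : K -> nat) : Prop := forall k, n <= rho k.

Lemma high_le m n rho : m <= n -> high n rho -> high m rho.
Proof. by move=> mn h k; apply: leq_trans mn (h k). Qed.

Lemma high_notin (s : seq nat) rho k : high (fresh s) rho -> rho k \notin s.
Proof. by move=> h; apply: mem_fresh. Qed.

Lemma unhenkin_imp rho A B :
  unhenkin rho (Imp A B) = Imp (unhenkin rho A) (unhenkin rho B).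
Proof. by []. Qed.

Lemma unhenkin_eqv rho A B :
  unhenkin rho (Eqv A B) = Eqv (unhenkin rho A) (unhenkin rho B).
Proof. by []. Qed.

Lemma unhenkin_all rho x A : unhenkin rho (All x A) = All x (unhenkin rho A).
Proof.
by congr All; apply: eq_lsubst => // v _; rewrite /upd; case: eqP => [->|].
Qed.

Lemma fv_unhenkin rho A u : u \in fv (unhenkin rho A) ->
  u \in fv A \/ exists k, u = rho k.
Proof.
move=> /fv_lsubst [[v vA]|[[c|k] _ //]]; first by rewrite inE => /eqP ->; left.
by rewrite inE => /eqP ->; right; exists k.
Qed.

Lemma fv_unhenkin_mem rho A u : u \in fv A -> u \in fv (unhenkin rho A).
Proof. exact: fv_lsubst_var. Qed.

Lemma Fm_unhenkin rho A : Fm A -> Fm (unhenkin rho A).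
Proof. by move=> FA; apply: Fm_lsubst => // -[]. Qed.

Lemma bv_unhenkin rho A : bv (unhenkin rho A) = bv A.
Proof.
suff H s : (forall v, bv (s v) = [::]) -> bv (lsubst (var_of_cst rho) s A) = bv A by
  exact: H.
elim: A s => [x|[c|k]|A IH|A IHA B IHB|A IHA B IHB|A IHA B IHB|A IHA B IHB|A IH|x A IH]
  s //= hs;
  rewrite ?IH ?IHA ?IHB // => v.
by rewrite /upd; case: eqP.
Qed.

Lemma no_capture_unhenkin rho A : high (fresh (bv A)) rho ->
  no_capture (var_of_cst rho) Var A.
Proof.
move=> h; apply: no_capture_bv => [v|[c|k] y yA //]; first by left.
by rewrite inE; apply: contraTneq yA => ->; apply: high_notin.
Qed.

(** The bound on [rho] also exceeds [x], since a constant turned into [x] would be hit by the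
    substitution on the right. Above the bound variables of [A] nothing is renamed, so [subst] acts
    literally. *)
Lemma unhenkin_lsubst1 rho A x B : {in bv A, forall y, y \notin fv B} ->
  high (fresh (x :: bv A)) rho ->
  unhenkin rho (lsubst1 A x B) = subst (unhenkin rho A) x (unhenkin rho B).
Proof.
move=> hB h; have hb : high (fresh (bv A)) rho.
  by apply: high_le h; rewrite /fresh /=; lia.
rewrite /subst msubst_lsubst; last first.
  apply: no_capture_bv => // v; rewrite /upd; case: eqP => _; [right|by left].
  move=> y; rewrite bv_unhenkin => yA; apply/negP => /fv_unhenkin [|[k yk]].
    by rewrite (negPf (hB y yA)).
  by move: (high_notin k hb); rewrite -yk yA.
rewrite /unhenkin /lsubst1 !lsubst_comp; last 2 first.
- exact: no_capture_unhenkin.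
- by apply: no_capture_bv => // v; rewrite /upd; case: eqP => _; [right|left].
apply: eq_lsubst => [[c|k] _ //=|v _]; last by rewrite /= /upd; case: eqP.
by have := high_notin k h; rewrite inE negb_or => /andP[kx _]; rewrite upd_neq.
Qed.

(** * Derivability in the extended language *)

Definition hyps rho (l : seq HForm) : set (form C) :=
  fun X => exists2 B, List.In B l & X = unhenkin rho B.

(** All high [rho] are required, with the same [rho] for premises and conclusion: a single witness
    can then be moved to a fresh variable while the other constants keep theirs. *)
Definition hderives (l : seq HForm) (A : HForm) : Prop :=
  exists n, forall rho, high n rho -> derives L (hyps rho l) (unhenkin rho A).

(** Kept apart from [hderives], because only axioms may be boxed. *)
Definition haxiom (A : HForm) : Prop :=
  exists n, forall rho, high n rho -> Defs.axiom L (unhenkin rho A).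

Lemma haxiom_derives l A : haxiom A -> hderives l A /\ hderives l (Box A).
Proof.
by move=> [n h]; split; exists n => rho /h a; [apply: derives_axiom|apply: derives_nec].
Qed.

Lemma hderives_hyp l A : List.In A l -> hderives l A.
Proof. by move=> Al; exists 0 => rho _; apply: derives_hyp; exists A. Qed.

Lemma hderives_sub l l' A : (forall B, List.In B l -> List.In B l') ->
  hderives l A -> hderives l' A.
Proof.
move=> sub [n h]; exists n => rho /h; apply: derives_sub => B [D /sub Dl ->].
by exists D.
Qed.

Lemma hderives_mp l A B : hderives l A -> hderives l (Imp A B) -> hderives l B.
Proof.
move=> [n hn] [m hm]; exists (maxn m n) => rho h.
by apply: derives_mp (hn rho _) (hm rho _); apply: high_le h; lia.
Qed.

Lemma hyps_Fm rho l : (forall B, List.In B l -> Fm B) ->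
  forall B, hyps rho l B -> Fm B.
Proof. by move=> Fl _ [B /Fl FB ->]; apply: Fm_unhenkin. Qed.

Lemma hderives_deduction l A B : Fm A -> (forall B, List.In B l -> Fm B) ->
  hderives (A :: l) B -> hderives l (Imp A B).
Proof.
move=> FA Fl [n h]; exists n => rho /h d; apply: deduction.
- exact: Fm_unhenkin.
- exact: hyps_Fm.
by apply: derives_sub d => _ [D [<-|Dl] ->]; [left|right; exists D].
Qed.

(** The eigenvariable argument: with the witness read as a fresh [z], the extra premise says that
    [A] at [z] implies [All x A]. If [B] failed, [A] would hold at [z], hence [All x A] by
    generalisation; this makes the premise true and yields [B]. *)
Lemma hderives_witness x A l B : sentence (All x A) ->
  (forall D, List.In D l -> sentence D) -> sentence B ->
  (forall D, List.In D (B :: l) -> ~ occ (inr (KAll x (code A)) : HC) D) ->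
  hderives (henkin_axiom x A :: l) B -> hderives l B.
Proof.
move=> [[xA FA] _] sl [FB _]; set w := KAll x (code A) => nocc [n hn].
exists (maxn n (fresh (x :: bv A))) => rho hrho.
set A' := unhenkin rho A; set b := unhenkin rho B.
(* [n] is listed so that [z] is itself a high value, and the bound variables of [A] so that putting
   [z] for [x] renames nothing. *)
set names := n :: x :: bv A ++ fv A' ++ fv b ++ flatten [seq fv (unhenkin rho D) | D <-
  l].
set z := fresh names.
have zN : z \notin names by apply: mem_fresh.
have nz : n < z by rewrite ltnNge; apply/negP => /mem_fresh; rewrite inE eqxx.
move: zN; rewrite !inE !mem_cat !negb_or => /and5P[_ zx zbv zA' /andP[zb zl]].
(* Only the witness is moved. It occurs neither in [A], by size, nor in [B] and [l], by hypothesis,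
   so these translate as under [rho]. *)
pose rho' k := if pselect (k = w) then z else rho k.
have rho'w : rho' w = z by rewrite /rho'; case: (pselect (w = w)).
have uw : unhenkin rho' (witness x A) = Var z by congr Var.
have hrho' : high (maxn n (fresh (x :: bv A))) rho'.
  move=> k; rewrite /rho'; case: pselect => ?; last exact: hrho.
  rewrite geq_max ltnW //=; apply: fresh_sub => y.
  by rewrite !inE mem_cat => /orP[] ->; rewrite !orbT.
have same D : ~ occ (inr w : HC) D -> unhenkin rho' D = unhenkin rho D.
  move=> nD; apply: eq_lsubst => // -[c|k] //= kD; congr Var.
  by rewrite /rho'; case: pselect => // kw; case: nD; rewrite -kw.
have nwA : ~ occ (inr w : HC) A by move=> /ksize_occ /=; lia.
set Az := subst A' x (Var z).
have AzE : Az = lsubst1 A' x (Var z).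
  rewrite /Az /subst msubst_lsubst //; apply: no_capture_bv => // v.
  rewrite /upd; case: eqP => _; [right=> y|by left].
  by rewrite bv_unhenkin inE => yA; apply: contraNneq zbv => <-.
have xA' : x \in fv A' by apply: fv_unhenkin_mem.
have FA' : Fm A' by apply: Fm_unhenkin.
have Fb : Fm b by apply: Fm_unhenkin.
have FAz : Fm Az by rewrite AzE; apply: Fm_lsubst => // v; rewrite /upd; case: eqP.
have zAz : z \in fv Az.
  rewrite AzE; apply: (fv_lsubst_mem (v := x)) => //; last by rewrite upd_same inE.
  apply: no_capture_bv => // v; rewrite /upd; case: eqP => _; [right=> y|by left].
  by rewrite bv_unhenkin inE => yA; apply: contraNneq zbv => <-.
have Fl : forall D, hyps rho l D -> Fm D by apply: hyps_Fm => D /sl [].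
have d0 : derives L (hyps rho l) (Imp (Imp Az (All x A')) b).
  apply: deduction => //.
  rewrite /b -(same B); last by apply: nocc; left.
  apply: derives_sub (hn rho' _) => [_ [D [<-|Dl] ->]|]; last by apply: high_le hrho';
    lia.
    left; rewrite unhenkin_imp unhenkin_all unhenkin_lsubst1 //;
      last by apply: high_le hrho'; lia.
    by rewrite (same A nwA) uw.
  by right; exists D => //; apply: same; apply: nocc; right.
have d1 : derives L (hyps rho l) (Imp (Neg b) Az).
  apply: derives_mp d0 _.
  by apply: (derives_taut (p := PImp (PImp (PImp (PVar 0) (PVar 1)) (PVar 2))
      (PImp (PNeg (PVar 2)) (PVar 0))) (s := nth b [:: Az; All x A'; b])) => // v /=;
    case: (v 0); case: (v 1); case: (v 2).
have d2 : derives L (hyps rho l) (Imp (Neg b) (All z Az)).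
  have zI : z \in fv b ++ fv Az by rewrite mem_cat zAz orbT.
  apply: derives_mp (generalization Fl _ d1 zI) _.
    by move=> _ [D Dl ->]; apply: contra zl => /(In_flatten (f := fun D => fv (unhenkin
      rho D)) Dl).
  by apply: derives_schema; [|apply: sch_all_const].
have d3 : derives L (hyps rho l) (Imp (All z Az) (All x A')).
  apply: derives_mp (derives_schema _ (sch_eqv_imp _ _ _)) => //.
  apply: derives_schema => //; apply/sch_alpha/alpha_sym/alpha_rename => //.
apply: derives_mp d0 _; apply: derives_mp d3 _; apply: derives_mp d2 _.
by apply: (derives_taut (p := PImp (PImp (PNeg (PVar 2)) (PVar 3))
    (PImp (PImp (PVar 3) (PVar 1)) (PImp (PImp (PImp (PVar 0) (PVar 1)) (PVar 2)) (PVar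
      2))))
    (s := nth b [:: Az; All x A'; b; All z Az])) => // v /=;
  case: (v 0); case: (v 1); case: (v 2); case: (v 3).
Qed.

End Henkin.

(** * Sentences and formulas in one variable *)

Definition unary (C : constants) (x : nat) (A : form C) : Prop :=
  Fm A /\ {subset fv A <= [:: x]}.

Lemma sentenceP (C : constants) (A : form C) : sentence A <-> Fm A /\ forall v, v
  \notin fv A.
Proof.
split=> -[FA hA]; split=> //; first by move=> v; rewrite hA.
by case: (fv A) hA => // v l /(_ v); rewrite inE eqxx.
Qed.

Lemma sentence_all (C : constants) x (A : form C) :
  sentence (All x A) <-> x \in fv A /\ unary x A.
Proof.
split=> [/sentenceP [[xA FA] h]|[xA [FA h]]].
  split=> //; split=> // v vA; rewrite inE; move: (h v).
  by rewrite mem_filter vA andbT negbK.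
apply/sentenceP; split=> // v; rewrite mem_filter; apply/negP => /andP[vx /h].
by rewrite inE (negPf vx).
Qed.

Lemma sentence_lsubst1 (C : constants) x (A B : form C) :
  unary x A -> sentence B -> sentence (lsubst1 A x B).
Proof.
move=> [FA h] /sentenceP [FB hB]; apply/sentenceP; split.
  by apply: Fm_lsubst => // v; rewrite /upd; case: eqP.
move=> u; apply/negP => /fv_lsubst [[v /h]|[]//].
by rewrite inE => /eqP ->; rewrite upd_same (negPf (hB u)).
Qed.

Lemma occ_lsubst1 (C : constants) x (A B : form C) c :
  occ c (lsubst1 A x B) -> occ c A \/ occ c B.
Proof.
by move=> /occ_lsubst [[v]|[d dA <-//]]; [rewrite /upd; case: eqP => //; right|left].
Qed.

(** * Conservativity and maximal theories *)

Section Lindenbaum.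
Variables (C : constants) (L : system).
Local Notation K := (henkin_const C).
Local Notation HC := (henkin_constants C).
Local Notation HForm := (form HC).
Local Notation hderives := (@hderives C L).
Local Notation haxiom := (@haxiom C L).

Lemma sentence_embed s (A : form C) :
  Fm A -> (forall v, sentence (s v)) -> sentence (embed s A).
Proof.
move=> FA hs; apply/sentenceP; split; first by apply: Fm_lsubst => // v; case: (hs v).
by move=> u; apply/negP => /fv_lsubst [[v _]|[]//]; case: (hs v) => _ ->.
Qed.

Definition provable (S : set HForm) (A : HForm) : Prop :=
  exists2 l, (forall B, List.In B l -> S B) & hderives l A.

Lemma provable_hyp S A : S A -> provable S A.
Proof. by exists [:: A]; [move=> B [<-|]|apply: hderives_hyp; left]. Qed.

Lemma provable_axiom S A : haxiom A -> provable S A /\ provable S (Box A).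
Proof. by move=> /(@haxiom_derives _ _ [::]) [? ?]; split; exists [::]. Qed.

Lemma provable_mp S A B : provable S A -> provable S (Imp A B) -> provable S B.
Proof.
move=> [l hl dl] [l' hl' dl']; exists (l ++ l').
  by move=> D /List.in_app_iff [/hl|/hl'].
by apply: hderives_mp (hderives_sub _ dl) (hderives_sub _ dl') => D Dl;
  apply/List.in_app_iff; [left|right].
Qed.

Lemma provable_deduction S A B : Fm A -> (forall D, S D -> Fm D) ->
  provable (S `|` [set A]) B -> provable S (Imp A B).
Proof.
move=> FA FS [l hl d].
have [l' hl' sub] : exists2 l', (forall D, List.In D l' -> S D) &
    forall D, List.In D l -> D = A \/ List.In D l'.
  elim: l hl {d} => [|D l IH] hl; first by exists [::].
  have [l' hl' sub] := IH (fun E El => hl E (or_intror El)).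
  case: (hl D (or_introl erefl)) => [SD|->].
    exists (D :: l') => [E [<-//|/hl'//]|E [<-|/sub [->|El]]]; first by right; left.
    - by left.
    - by right; right.
  by exists l' => // E [<-|/sub]; [left|].
exists l' => //; apply: hderives_deduction => // [D /hl' /FS//|].
by apply: hderives_sub d => D /sub [->|]; [left|right].
Qed.

Lemma haxiom_taut p s : tautology p -> Fm (pinst s p) -> haxiom (pinst s p).
Proof.
move=> tp Fp; exists 0 => rho _; apply: axiom_schema; first exact: Fm_unhenkin.
have -> : unhenkin rho (pinst s p) = pinst (fun i => unhenkin rho (s i)) p.
  elim: p {tp Fp} => //= [p IH|p IHp q IHq|p IHp q IHq|p IHp q IHq];
  by rewrite -?IH -?IHp -?IHq.
exact: sch_taut.
Qed.

Section Theory.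
Variables (Phi : set (form C)) (phi : form C).
Hypotheses (FPhi : forall B, Phi B -> Fm B) (Fphi : Fm phi).

Local Notation star := (embed (@henkin_var C)).

Lemma sentence_star A : Fm A -> sentence (star A).
Proof. by move=> FA; apply: sentence_embed. Qed.

(** Stratified by the size of the code, so that the largest witnesses can be eliminated first. *)
Definition henkin_upto (n : nat) : set HForm := fun D =>
  (exists2 B, Phi B & D = star B) \/
  exists x A, [/\ sentence (All x A), ksize (code A) < n & D = henkin_axiom x A].

Lemma sentence_henkin x (A : HForm) : sentence (All x A) -> sentence (henkin_axiom x A).
Proof.
move=> sA; have [xA uA] := proj1 (sentence_all x A) sA.
have [Fs fs] : sentence (lsubst1 A x (witness x A)) by apply: sentence_lsubst1.
by case: sA => FA fA; split=> //=; rewrite fs /= -[RHS]fA.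
Qed.

Lemma henkin_upto_sentence n D : henkin_upto n D -> sentence D.
Proof.
by case=> [[B /FPhi FB ->]|[x [A [sA _ ->]]]];
  [apply: sentence_star|apply: sentence_henkin].
Qed.

(** The embedding introduces only constants [KVar], which are never witnesses. *)
Lemma occ_star x k (A : form C) : ~ occ (inr (KAll x k) : HC) (star A).
Proof. by move=> /occ_lsubst [[v []]|[c]]. Qed.

(** By size, a witness can occur only in its own axiom and in those of strictly larger formulas;
    injectivity of [code] identifies the former. *)
Lemma occ_henkin_upto n D x A : henkin_upto n D -> n <= (ksize (code A)).+1 ->
  occ (inr (KAll x (code A)) : HC) D -> D = henkin_axiom x A.
Proof.
case=> [[B _ ->] _ /occ_star //|[y [B [_ lt_n ->]]] le_n [/occ_lsubst1 [|]|]].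
- by move=> /ksize_occ /=; lia.
- by move=> [-> /code_inj ->].
- by move=> /= /ksize_occ /=; lia.
Qed.

(* A witness of maximal size occurs in no other premise. *)
Lemma provable_upto n A : Fm A -> provable (henkin_upto n.+1) (star A) ->
  provable (henkin_upto n) (star A).
Proof.
move=> FA [l hl d].
suff H l2 : (forall D, List.In D l2 -> henkin_upto n D) -> hderives (l ++ l2) (star A)
  ->
    provable (henkin_upto n) (star A).
  by apply: (H [::]) => //; rewrite cats0.
elim: l l2 {d} hl => [|D l IH] l2 hl hl2 d; first by exists l2.
have hl' E : List.In E l -> henkin_upto n.+1 E by move=> El; apply: hl; right.
case: (pselect (henkin_upto n D)) => [hD|nD].
  apply: (IH (D :: l2)) => // [E [<-//|/hl2//]|].
  apply: hderives_sub d => E [<-|/List.in_app_iff [El|El]]; apply/List.in_app_iff;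
    [by right; left|by left|by right; right].
have [[B PB DB]|[x [B [sB lt_n DB]]]] := hl D (or_introl erefl).
  by case: nD; left; exists B.
have szB : ksize (code B) = n.
  case: (ltnP (ksize (code B)) n) => [lt_B|]; last by lia.
  by case: nD; right; exists x, B.
(* A premise may be listed twice, and the second copy would still contain the witness; one copy is
   then simply dropped. *)
case: (pselect (List.In D (l ++ l2))) => [Dl|nDl].
  by apply: (IH l2) => //; apply: hderives_sub d => E [<-|].
have hll2 E : List.In E (l ++ l2) -> henkin_upto n.+1 E.
  move=> /List.in_app_iff [/hl'//|/hl2 [|[y [E' [? lt_E ?]]]]]; first by left.
  by right; exists y, E'; split=> //; lia.
apply: (IH l2) => //; rewrite DB in d nDl; apply: hderives_witness d => //.
- by move=> E /hll2 /henkin_upto_sentence.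
- exact: sentence_star.
- move=> E [<-|El]; first exact: occ_star.
  move=> /(occ_henkin_upto (hll2 _ El)); rewrite szB => /(_ (leqnn _)) EB.
  by apply: nDl; rewrite -EB.
Qed.

Definition henkin_base : set HForm := fun D => exists n, henkin_upto n D.

Lemma henkin_upto_le m n : m <= n -> henkin_upto m `<=` henkin_upto n.
Proof.
move=> mn D [|[x [A [sA lt_m DA]]]]; first by left.
by right; exists x, A; split=> //; apply: leq_trans mn.
Qed.

Lemma provable_base A : Fm A -> provable henkin_base (star A) ->
  exists2 l, (forall D, List.In D l -> exists2 B, Phi B & D = star B) & hderives l
    (star A).
Proof.
move=> FA [l hl d].
have [n hn] : exists n, forall D, List.In D l -> henkin_upto n D.
  elim: l hl {d} => [|D l IH] hl; first by exists 0.
  have [n hn] := IH (fun E El => hl E (or_intror El)).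
  have [m hm] := hl D (or_introl erefl).
  exists (maxn m n) => E [<-|/hn]; last by apply: henkin_upto_le; lia.
  by apply: henkin_upto_le hm; lia.
have {hn d} : provable (henkin_upto n) (star A) by exists l.
elim: n => [[l' hl' d]|n IH /(provable_upto FA)//].
by exists l' => // D /hl' [//|[x [B []]]].
Qed.

(** Once the Henkin axioms are gone, the finitely many premises from [Phi] are moved into the
    conclusion. The free variables are then restored in a derivation without hypotheses, where
    nothing restricts generalisation. *)
Lemma conservative A : Fm A -> provable henkin_base (star A) -> derives L Phi A.
Proof.
move=> FA /(provable_base FA) [l hl d].
elim: l A FA hl d => [|D l IH] A FA hl d.
  have [n {d}hn] := d.
  pose N := maxn n (fresh (fv A ++ bv A)).
  (* With [KVar v] read as [v + N], translating [star A] back gives [A] with its free variables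
     shifted by [N]; the other constants just get a high value. *)
  pose rho (k : K) := if k is KVar v then v + N else N.
  have hrho : high n rho by move=> k; rewrite /rho /N; case: k => *; lia.
  have := hn rho hrho; rewrite /unhenkin /embed lsubst_comp; last first.
    by apply: no_capture_bv => // v; right.
  move=> d; apply: (@derives_sub _ _ set0) => //.
  apply: (derives_shift (n := N)) => //; first by rewrite /N; lia.
  by apply: derives_sub d => B [D []].
have [B PB DB] := hl D (or_introl erefl); have FB := FPhi PB.
apply: derives_mp (derives_hyp L PB) _; apply: IH => //.
  by move=> E El; apply: hl; right.
rewrite DB in d; apply: (@hderives_deduction _ _ l (star B) (star A)) => //.
- by case: (sentence_star FB).
- by move=> E El; have [B' /FPhi FB' ->] := hl E (or_intror El);
    case: (sentence_star FB').
Qed.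

Hypothesis nphi : ~ derives L Phi phi.

Lemma lindenbaum : exists T : set HForm,
  [/\ henkin_base `<=` T, forall A, T A -> sentence A, ~ provable T (star phi) &
      forall A, sentence A -> ~ T A -> provable (T `|` [set A]) (star phi)].
Proof.
have base_sentence D : henkin_base D -> sentence D by move=> [n /henkin_upto_sentence].
(* [henkin_base] is built into the condition instead of being contained in [S], because the chains
   of [Zorn_bigcup] include the empty one. *)
pose P (S : set HForm) := (forall A, S A -> sentence A) /\
  ~ provable (henkin_base `|` S) (star phi).
have [F FP tot|S [[sS cS] maxS]] := @Zorn_bigcup _ P.
  split=> [A [S FS SA]|[l hl d]]; first by case: (FP S FS) => h _; apply: h.
  have [hb|[S FS hS]] : (forall D, List.In D l -> henkin_base D) \/
      exists2 S, F S & forall D, List.In D l -> (henkin_base `|` S) D.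
  - elim: l hl {d} => [|D l IH] hl; first by left.
    have hD := hl D (or_introl erefl).
    case: (IH (fun E El => hl E (or_intror El))) => [hb|[S FS hS]].
      case: hD => [bD|[S FS SD]]; first by left=> E [<-|/hb].
      by right; exists S => // E [<-|/hb]; [right|left].
    right; case: hD => [bD|[S' FS' SD]].
      by exists S => // E [<-|/hS]; [left|].
    case: (tot S S' FS FS') => sub.
      exists S' => // E [<-|/hS [|/sub]]; [by right|by left|by right].
    by exists S => // E [<-|/hS //]; right; apply: sub.
  - by apply/nphi/conservative => //; exists l.
  by case: (FP S FS) => _; apply; exists l.
exists (henkin_base `|` S); split.
- by left.
- by move=> A [/base_sentence|/sS].
- exact: cS.
move=> A sA nA; apply: contrapT => nprov; apply: (maxS (S `|` [set A])).
  split; first by left.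
  by move=> /(_ A (or_intror erefl)) SA; apply: nA; right.
by split=> [B [/sS|->]|] //; rewrite setUA.
Qed.

End Theory.
End Lindenbaum.

Lemma sentence_cst (D : constants) (c : D) : sentence (Cst c). Proof. by []. Qed.

Lemma sentence_neg (D : constants) (A : form D) : sentence A -> sentence (Neg A).
Proof. by []. Qed.

Lemma sentence_box (D : constants) (A : form D) : sentence A -> sentence (Box A).
Proof. by []. Qed.

Lemma sentence_imp (D : constants) (A B : form D) :
  sentence A -> sentence B -> sentence (Imp A B).
Proof. by move=> [FA fA] [FB fB]; split=> //=; rewrite fA fB. Qed.

(** Well-formedness and free variables are computed alike for all binary connectives, so the
    statements are convertible. *)
Lemma sentence_or (D : constants) (A B : form D) :
  sentence A -> sentence B -> sentence (Or A B).
Proof. exact: sentence_imp. Qed.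

Lemma sentence_and (D : constants) (A B : form D) :
  sentence A -> sentence B -> sentence (And A B).
Proof. exact: sentence_imp. Qed.

Lemma sentence_eqv (D : constants) (A B : form D) :
  sentence A -> sentence B -> sentence (Eqv A B).
Proof. exact: sentence_imp. Qed.

Lemma sentence_impP (D : constants) (A B : form D) :
  sentence (Imp A B) -> sentence A /\ sentence B.
Proof. by move=> [[FA FB]] /= f; split; split=> //; move: f; case: (fv A) => //=;
  case: (fv B). Qed.

Local Hint Resolve sentence_cst sentence_neg sentence_box sentence_imp sentence_or
  sentence_and sentence_eqv : core.

Lemma sentence_pinst (D : constants) (s : nat -> form D) p :
  (forall i, sentence (s i)) -> sentence (pinst s p).
Proof. by move=> hs; elim: p => //= *; auto. Qed.

(** * Axioms of the extended language and Henkin theories *)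

Section HenkinAxioms.
Variables (C : constants) (L : system).
Local Notation HC := (henkin_constants C).
Local Notation HForm := (form HC).
Local Notation haxiom := (@haxiom C L).
Implicit Types A B : HForm.

Lemma upd_Var (D : constants) x : upd (@Var D) x (Var x) = Var.
Proof. by apply: funext => v; rewrite /upd; case: eqP => [->|]. Qed.

Lemma haxiom_schema n A : Fm A ->
  (forall rho, high n rho -> schema L (unhenkin rho A)) -> haxiom A.
Proof.
by move=> FA h; exists n => rho /h; apply: axiom_schema; apply: Fm_unhenkin.
Qed.

Lemma haxiom_T A : Fm A -> haxiom (Imp (Box A) A).
Proof. by move=> FA; apply: (@haxiom_schema 0) => // rho _; apply: sch_T. Qed.

Lemma haxiom_K A B : Fm A -> Fm B ->
  haxiom (Imp (Box (Imp A B)) (Imp (Box A) (Box B))).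
Proof. by move=> FA FB; apply: (@haxiom_schema 0) => // rho _; apply: sch_K. Qed.

Lemma haxiom_S3 A B : Fm A -> Fm B ->
  haxiom (Imp (Box (Imp A B)) (Box (Imp (Box A) (Box B)))).
Proof. by move=> FA FB; apply: (@haxiom_schema 0) => // rho _; apply: sch_S3. Qed.

Lemma haxiom_4 A : L <> S3 -> Fm A -> haxiom (Imp (Box A) (Box (Box A))).
Proof. by move=> hL FA; apply: (@haxiom_schema 0) => // rho _; apply: sch_4. Qed.

Lemma haxiom_5 A : L = S5 -> Fm A -> haxiom (Imp (Neg (Box A)) (Box (Neg (Box A)))).
Proof. by move=> hL FA; apply: (@haxiom_schema 0) => // rho _; apply: sch_5. Qed.

Lemma haxiom_eqv_refl A : Fm A -> haxiom (Eqv A A).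
Proof. by move=> FA; apply: (@haxiom_schema 0) => // rho _;
  apply/sch_alpha/alpha_refl. Qed.

Lemma haxiom_eqv_imp A B : Fm A -> Fm B -> haxiom (Imp (Eqv A B) (Imp A B)).
Proof. by move=> FA FB; apply: (@haxiom_schema 0) => // rho _; apply: sch_eqv_imp. Qed.

Lemma haxiom_rename x z A : Fm A -> x \in fv A -> z \notin fv A -> z \notin bv A ->
  haxiom (Eqv (All x A) (All z (lsubst1 A x (Var z)))).
Proof.
(* [rho] must stay above [z], lest a constant of [A] become a free [z] and block the renaming. *)
move=> FA xA zA zbv; apply: (@haxiom_schema (maxn z.+1 (fresh (x :: bv A)))).
  split=> //; split.
    apply: (fv_lsubst_mem (v := x)) => //; last by rewrite upd_same inE.
    apply: no_capture_bv => // v; rewrite /upd; case: eqP => _; [right=> y|by left].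
    by rewrite inE => yA; apply: contraNneq zbv => <-.
  by apply: Fm_lsubst => // v; rewrite /upd; case: eqP.
move=> rho h; rewrite unhenkin_eqv !unhenkin_all; apply: sch_alpha.
rewrite unhenkin_lsubst1; last 2 first.
- by move=> y yA; rewrite inE; apply: contraNneq zbv => <-.
- by apply: high_le h; rewrite leq_maxr.
apply: alpha_rename; apply/negP => /fv_unhenkin [|[k zk]]; first by rewrite (negPf zA).
by move: (h k); rewrite -zk; lia.
Qed.

Lemma haxiom_eqv_subst x A B B' : unary x A -> x \in fv A -> sentence B -> sentence B'
  ->
  haxiom (Imp (Eqv B B') (Eqv (lsubst1 A x B) (lsubst1 A x B'))).
Proof.
move=> uA xA sB sB'; have [FB fB] := sB; have [FB' fB'] := sB'.
have [Fs _] := sentence_lsubst1 uA sB; have [Fs' _] := sentence_lsubst1 uA sB'.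
apply: (@haxiom_schema (fresh (x :: bv A))) => // rho h.
have [e e'] : unhenkin rho (lsubst1 A x B) = subst (unhenkin rho A) x (unhenkin rho B)
  /\
    unhenkin rho (lsubst1 A x B') = subst (unhenkin rho A) x (unhenkin rho B').
  by split; apply: unhenkin_lsubst1 => // y _; rewrite ?fB ?fB'.
rewrite unhenkin_imp !unhenkin_eqv e e'.
by apply: sch_eqv_subst; apply: fv_unhenkin_mem.
Qed.

Lemma haxiom_inst x A B : sentence (All x A) -> sentence B ->
  haxiom (Imp (All x A) (lsubst1 A x B)).
Proof.
move=> sA sB; have [_ uA] := proj1 (sentence_all x A) sA; have [FA _] := sA.
have [FB fB] := sB; have [Fs _] := sentence_lsubst1 uA sB.
apply: (@haxiom_schema (fresh (x :: bv A))) => // rho h.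
rewrite unhenkin_imp unhenkin_all unhenkin_lsubst1 //; first exact: sch_inst.
by move=> y _; rewrite fB.
Qed.

Lemma haxiom_eqv_all x A B : sentence (All x A) -> sentence (All x B) ->
  haxiom (Imp (All x (Eqv A B)) (Eqv (All x A) (All x B))).
Proof.
move=> [[xA FA] _] [[xB FB] _]; apply: (@haxiom_schema 0) => [|rho _].
  by split=> //=; split=> //; rewrite mem_cat xA.
by rewrite /unhenkin /= !upd_Var; apply: sch_eqv_all.
Qed.

Lemma haxiom_all_imp x A B : sentence (All x A) -> sentence (All x B) ->
  haxiom (Imp (All x (Imp A B)) (Imp (All x A) (All x B))).
Proof.
move=> [[xA FA] _] [[xB FB] _]; apply: (@haxiom_schema 0) => [|rho _].
  by split=> //=; split=> //; rewrite mem_cat xA.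
by rewrite /unhenkin /= !upd_Var; apply: sch_all_imp.
Qed.

Lemma haxiom_all_const x A B : sentence A -> sentence (All x B) ->
  haxiom (Imp (All x (Imp A B)) (Imp A (All x B))).
Proof.
(* Above [x], no constant of [A] can turn into a free [x]. *)
move=> [FA fA] [[xB FB] _]; apply: (@haxiom_schema x.+1) => [|rho h].
  by split=> //=; split=> //; rewrite mem_cat xB orbT.
rewrite /unhenkin /= !upd_Var; apply: sch_all_const.
apply/negP => /fv_unhenkin [|[k xk]]; first by rewrite fA.
by move: (h k); rewrite -xk ltnn.
Qed.

Lemma haxiom_cbarcan x A : sentence (All x A) -> haxiom (Imp (Box (All x A)) (All x
  (Box A))).
Proof.
move=> [FA _]; apply: (@haxiom_schema 0) => // rho _.
by rewrite /unhenkin /= !upd_Var; apply: sch_cbarcan.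
Qed.

Lemma haxiom_barcan x A : sentence (All x A) -> haxiom (Imp (All x (Box A)) (Box (All x
  A))).
Proof.
move=> [FA _]; apply: (@haxiom_schema 0) => // rho _.
by rewrite /unhenkin /= !upd_Var; apply: sch_barcan.
Qed.

(** The interface between the Lindenbaum construction and the canonical model. [ht_nec] is a clause
    of its own because membership in [T] does not carry over to boxes; [ht_imp] encodes
    maximality. *)
Record henkin_theory (T : set HForm) : Prop := HenkinTheory {
  ht_sentence : forall A, T A -> sentence A;
  ht_axiom : forall A, sentence A -> haxiom A -> T A;
  ht_nec : forall A, sentence A -> haxiom A -> T (Box A);
  ht_bot : ~ T (Cst (cbot HC));
  ht_imp : forall A B, sentence A -> sentence B -> (T (Imp A B) <-> (T A -> T B));
  ht_all : forall x A, sentence (All x A) ->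
    (forall B, sentence B -> T (lsubst1 A x B)) -> T (All x A) }.

Lemma henkin_theory_exists (Phi : set (form C)) (phi : form C) :
  (forall B : form C, Phi B -> Fm B) -> Fm phi -> ~ derives L Phi phi ->
  exists T, [/\ henkin_theory T, forall B : form C, Phi B -> T (embed (@henkin_var C)
    B) &
    ~ T (embed (@henkin_var C) phi)].
Proof.
move=> FPhi Fphi nphi; have [T [baseT sT cT maxT]] := lindenbaum FPhi Fphi nphi.
set f := embed _ phi in cT maxT *; have sf : sentence f by apply: sentence_star.
have FT D : T D -> Fm D by move=> /sT [].
have closed A : sentence A -> provable L T A -> T A.
  move=> sA pA; apply: contrapT => nA; apply: cT; apply: provable_mp pA _.
  by apply: provable_deduction => //; [case: sA|apply: maxT].
have taut p s : tautology p -> (forall i, sentence (s i)) -> provable L T (pinst s p).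
  move=> tp hs; apply: (proj1 (provable_axiom _ _)); apply: haxiom_taut => //.
  by case: (sentence_pinst p hs).
exists T; split.
- split=> //.
  + by move=> A sA aA; apply: closed => //; case: (provable_axiom T aA).
  + by move=> A sA aA; apply: closed => //; case: (provable_axiom T aA).
  + move=> Tbot; apply: cT; apply: provable_mp (provable_hyp _ Tbot) _.
    by apply: (taut (PImp PBot (PVar 0)) (fun=> f)).
  + move=> A B sA sB; split=> [TAB TA|AB].
      by apply: closed => //; apply: provable_mp (provable_hyp _ TA) (provable_hyp _
        TAB).
    case: (pselect (T A)) => [/AB TB|nA].
      apply: closed; first exact: sentence_imp.
      apply: provable_mp (provable_hyp _ TB) _.
      by apply: (taut (PImp (PVar 0) (PImp (PVar 1) (PVar 0))) (nth A [:: B;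
        A])) => [v /=|[|[|i]]] //;
        [case: (v 0); case: (v 1)|rewrite nth_default].
    (* Here [f] plays falsity: [A] and [Imp A B], both outside [T], imply it by maximality, and a
       tautology in the style of Peirce's law then derives it. *)
    apply: contrapT => nAB.
    have d1 : provable L T (Imp A f).
      by apply: provable_deduction => //; [case: sA|apply: maxT].
    have sAB : sentence (Imp A B) by apply: sentence_imp.
    have d2 : provable L T (Imp (Imp A B) f).
      by apply: provable_deduction => //; [case: sAB|apply: maxT].
    apply: cT; apply: provable_mp d2 _; apply: provable_mp d1 _.
    by apply: (taut (PImp (PImp (PVar 0) (PVar 2)) (PImp (PImp (PImp (PVar 0) (PVar 1))
      (PVar 2)) (PVar 2)))
        (nth A [:: A; B; f])) => [v /=|[|[|[|i]]]] //;
      [case: (v 0); case: (v 1); case: (v 2)|rewrite nth_default].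
  + move=> x A sA hA; apply: closed => //.
    have sw : sentence (witness x A) by [].
    apply: provable_mp (provable_hyp _ (hA _ sw)) _; apply: provable_hyp; apply: baseT.
    by exists (ksize (code A)).+1; right; exists x, A.
- by move=> B PB; apply: baseT; exists 0; left; exists B.
- by move=> /(provable_hyp L).
Qed.

End HenkinAxioms.

(** * The canonical model *)

Section Canonical.
Variables (C : constants) (L : system).
Local Notation HC := (henkin_constants C).
Local Notation HForm := (form HC).
Local Notation haxiom := (@haxiom C L).
Implicit Types A B D E : HForm.
Variable T : set HForm.
Hypothesis hT : henkin_theory L T.

(** * Closure properties of a Henkin theory *)

Lemma T_mp A B : T (Imp A B) -> T A -> T B.
Proof.
by move=> TAB; have [sA sB] := sentence_impP (ht_sentence hT TAB);
  apply/(ht_imp hT sA sB).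
Qed.

Lemma N_mp A B : T (Box (Imp A B)) -> T (Box A) -> T (Box B).
Proof.
(* [Box] changes neither well-formedness nor free variables, so the ascription holds by
   conversion. *)
move=> TAB; have [sA sB] := sentence_impP (ht_sentence hT TAB : sentence (Imp A B)).
apply: T_mp; apply: T_mp TAB.
by apply: (ht_axiom hT); auto; apply: haxiom_K; [case: sA|case: sB].
Qed.

Lemma T_taut p s : tautology p -> (forall i, sentence (s i)) -> T (pinst s p).
Proof.
move=> tp hs; have sp := sentence_pinst p hs; apply: (ht_axiom hT) => //.
by apply: haxiom_taut => //; case: sp.
Qed.

Lemma N_taut p s : tautology p -> (forall i, sentence (s i)) -> T (Box (pinst s p)).
Proof.
move=> tp hs; have sp := sentence_pinst p hs; apply: (ht_nec hT) => //.
by apply: haxiom_taut => //; case: sp.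
Qed.

Lemma T_refl A : sentence A -> T (Eqv A A).
Proof. by move=> sA; apply: (ht_axiom hT); auto; apply: haxiom_eqv_refl; case: sA. Qed.

Lemma T_eqv_sentence A B : T (Eqv A B) -> sentence A /\ sentence B.
Proof. by move=> /(ht_sentence hT) s; apply: (@sentence_impP _ A B). Qed.

Lemma T_eqv_imp A B : T (Eqv A B) -> T A -> T B.
Proof.
move=> TAB; have [sA sB] := T_eqv_sentence TAB; apply: T_mp; apply: T_mp TAB.
by apply: (ht_axiom hT); auto; apply: haxiom_eqv_imp; [case: sA|case: sB].
Qed.

(** [sch_eqv_subst] asks [x] to be free in [A]; otherwise both instances are [A] itself and
    reflexivity serves. *)
Lemma T_eqv_subst x A B B' : unary x A -> T (Eqv B B') ->
  T (Eqv (lsubst1 A x B) (lsubst1 A x B')).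
Proof.
move=> uA TB; have [sB sB'] := T_eqv_sentence TB.
have [s1 s2] := (sentence_lsubst1 uA sB, sentence_lsubst1 uA sB').
case: (boolP (x \in fv A)) => xA; last by move: s1; rewrite !lsubst1_notin //;
  apply: T_refl.
by apply: T_mp TB; apply: (ht_axiom hT); auto; apply: haxiom_eqv_subst.
Qed.

(** Replacing [A] by [B] in the context [Eqv (Var 0) A] turns reflexivity into [Eqv B A];
    transitivity uses the context [Eqv A (Var 0)] in the same way. *)
Lemma T_eqv_sym A B : T (Eqv A B) -> T (Eqv B A).
Proof.
move=> TAB; have [sA sB] := T_eqv_sentence TAB.
have u : unary 0 (Eqv (Var 0) A) by case: sA => FA fA; split=> //=; rewrite fA.
have := T_eqv_subst u TAB; rewrite /lsubst1 /= -!/(lsubst1 _ _ _) !lsubst1_notin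
  ?(proj2 sA) //.
by move=> /T_eqv_imp; apply; apply: T_refl.
Qed.

Lemma T_eqv_trans A B D : T (Eqv A B) -> T (Eqv B D) -> T (Eqv A D).
Proof.
move=> TAB TBD; have [sA sB] := T_eqv_sentence TAB.
have u : unary 0 (Eqv A (Var 0)) by case: sA => FA fA; split=> //=; rewrite fA.
have := T_eqv_subst u TBD; rewrite /lsubst1 /= -!/(lsubst1 _ _ _) !lsubst1_notin
  ?(proj2 sA) //.
by move=> /T_eqv_imp; apply.
Qed.

Lemma T_cong_neg A A' : T (Eqv A A') -> T (Eqv (Neg A) (Neg A')).
Proof.
have u : unary 0 (Neg (Var 0) : HForm) by split.
exact: (T_eqv_subst u).
Qed.

Lemma T_cong_box A A' : T (Eqv A A') -> T (Eqv (Box A) (Box A')).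
Proof.
have u : unary 0 (Box (Var 0) : HForm) by split.
exact: (T_eqv_subst u).
Qed.

Lemma T_cong2 (op : HForm -> HForm -> HForm) :
  (forall A B, fv (op A B) = fv A ++ fv B) ->
  (forall A B, Fm A -> Fm B -> Fm (op A B)) ->
  (forall A B s, lsubst Cst s (op A B) = op (lsubst Cst s A) (lsubst Cst s B)) ->
  forall A A' B B', T (Eqv A A') -> T (Eqv B B') -> T (Eqv (op A B) (op A' B')).
Proof.
move=> fv_op Fm_op op_lsubst A A' B B' TA TB.
have [_ [FA fA]] := T_eqv_sentence TA; have [[FB fB] _] := T_eqv_sentence TB.
have u1 : unary 0 (op (Var 0) B) by split; [apply: Fm_op|rewrite fv_op fB].
have u2 : unary 0 (op A' (Var 0)) by split; [apply: Fm_op|rewrite fv_op fA].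
have := T_eqv_subst u2 TB; have := T_eqv_subst u1 TA; rewrite /lsubst1 !op_lsubst /=.
rewrite !(@lsubst_id _ B) ?fB // !(@lsubst_id _ A') ?fA //.
exact: T_eqv_trans.
Qed.

Lemma T_cong_imp A A' B B' : T (Eqv A A') -> T (Eqv B B') -> T (Eqv (Imp A B) (Imp A'
  B')).
Proof. exact: (@T_cong2 (@Imp HC)). Qed.

Lemma T_cong_or A A' B B' : T (Eqv A A') -> T (Eqv B B') -> T (Eqv (Or A B) (Or A' B')).
Proof. exact: (@T_cong2 (@Or HC)). Qed.

Lemma T_cong_and A A' B B' : T (Eqv A A') -> T (Eqv B B') -> T (Eqv (And A B) (And A'
  B')).
Proof. exact: (@T_cong2 (@And HC)). Qed.

Lemma T_cong_eqv A A' B B' : T (Eqv A A') -> T (Eqv B B') -> T (Eqv (Eqv A B) (Eqv A'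
  B')).
Proof. exact: (@T_cong2 (@Eqv HC)). Qed.

(** * Classes of sentences modulo identity *)

Definition top : HForm := Cst (ctop HC).

(** The choice depends on the set alone, so sentences with the same equivalence class receive equal
    normal forms. *)
Definition choose_form (S : set HForm) : HForm :=
  if pselect (exists B, S B) is left e then sval (cid e) else top.

Lemma choose_formP (S : set HForm) A : S A -> S (choose_form S).
Proof.
move=> SA; rewrite /choose_form; case: pselect => [e|[]]; last by exists A.
exact: (svalP (cid e)).
Qed.

(* Formulas which are not sentences are sent to the class of [top]. *)
Definition normal_form A : HForm :=
  choose_form [set B | T (Eqv (if pselect (sentence A) then A else top) B)].

Lemma normal_formP A : sentence A -> T (Eqv A (normal_form A)).
Proof.
move=> sA; rewrite /normal_form; case: pselect => // ?.
by apply: (@choose_formP [set B | T (Eqv A B)] A); apply: T_refl.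
Qed.

Lemma sentence_normal_form A : sentence (normal_form A).
Proof.
case: (pselect (sentence A)) => [/normal_formP /T_eqv_sentence []//|nA].
rewrite /normal_form; case: pselect => // ?.
have : T (Eqv top (choose_form [set B | T (Eqv top B)])).
  by apply: (@choose_formP [set B | T (Eqv top B)] top); apply: T_refl.
by move=> /T_eqv_sentence [].
Qed.

Lemma normal_form_eq A B : T (Eqv A B) -> normal_form A = normal_form B.
Proof.
move=> TAB; have [sA sB] := T_eqv_sentence TAB.
rewrite /normal_form; case: pselect => // ?; case: pselect => // ?; congr choose_form.
by apply/seteqP; split=> D /=; apply: T_eqv_trans => //; apply: T_eqv_sym.
Qed.

Lemma normal_formK A : normal_form (normal_form A) = normal_form A.
Proof.
case: (pselect (sentence A)) => [sA|nA].
  by apply/esym/normal_form_eq/normal_formP.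
have -> : normal_form A = normal_form top.
  by rewrite /normal_form; case: pselect => // ?; case: pselect.
by apply/esym/normal_form_eq/normal_formP.
Qed.

(** The quotient as the type of fixed points of [normal_form]: identified sentences give literally
    equal elements, as the truth condition of [f_eqv] demands. *)
Definition cls_type := {A : HForm | normal_form A = A}.
Definition cls A : cls_type := exist _ (normal_form A) (normal_formK A).
Definition rep (a : cls_type) : HForm := sval a.

Lemma rep_inj : injective rep.
Proof. by move=> [A hA] [B hB] /= AB; move: hA; rewrite AB => hA; congr exist;
  apply: Prop_irrelevance. Qed.

Lemma sentence_rep a : sentence (rep a).
Proof. by case: a => A /= <-; apply: sentence_normal_form. Qed.
Local Hint Resolve sentence_rep : core.

Lemma repK a : cls (rep a) = a.
Proof. by apply: rep_inj; case: a. Qed.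

Lemma rep_cls A : sentence A -> T (Eqv A (rep (cls A))).
Proof. exact: normal_formP. Qed.

Lemma cls_eq A B : T (Eqv A B) -> cls A = cls B.
Proof. by move=> TAB; apply: rep_inj; apply: normal_form_eq. Qed.

Lemma cls_eqP A B : sentence A -> sentence B -> cls A = cls B <-> T (Eqv A B).
Proof.
move=> sA sB; split=> [e|/cls_eq //]; apply: T_eqv_trans (rep_cls sA) _; rewrite e.
exact/T_eqv_sym/rep_cls.
Qed.

(* [sentence (All p.1 p.2)] forces [p.1] to be free in [p.2]. *)
Definition represents (t : cls_type -> cls_type) (p : nat * HForm) : Prop :=
  sentence (All p.1 p.2) /\ forall m, t m = cls (lsubst1 p.2 p.1 (rep m)).

(** The chosen representation is immaterial by [represents_all_eq]. The default branch evaluates at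
    an arbitrary point, which is right for a constant function. *)
Definition cls_all (t : cls_type -> cls_type) : cls_type :=
  match pselect (exists p, represents t p) with
  | left e => let p := sval (cid e) in cls (All p.1 p.2)
  | right _ => t (cls top)
  end.

Definition canonical : domain C := {|
  dom := cls_type;
  TRUE := [set a | T (rep a)];
  NEC := [set a | T (Box (rep a))];
  f_bot := cls (Cst (cbot HC));
  f_top := cls top;
  f_box := fun a => cls (Box (rep a));
  f_neg := fun a => cls (Neg (rep a));
  f_or := fun a b => cls (Or (rep a) (rep b));
  f_and := fun a b => cls (And (rep a) (rep b));
  f_imp := fun a b => cls (Imp (rep a) (rep b));
  f_eqv := fun a b => cls (Eqv (rep a) (rep b));
  f_all := cls_all;
  Gamma := fun c => cls (Cst (inl c : HC));
  Gamma_bot := erefl;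
  Gamma_top := erefl |}.

Local Notation M := canonical.
Implicit Types (a b c : M) (t : M -> M).

Lemma TRUE_cls A : sentence A -> TRUE M (cls A) <-> T A.
Proof.
move=> /rep_cls TA; split; apply: T_eqv_imp => //; exact: T_eqv_sym.
Qed.

Lemma NEC_cls A : sentence A -> NEC M (cls A) <-> T (Box A).
Proof.
move=> /rep_cls /T_cong_box TA; split; apply: T_eqv_imp => //; exact: T_eqv_sym.
Qed.

Lemma cls_imp A B : sentence A -> sentence B -> @f_imp _ M (cls A) (cls B) = cls (Imp A
  B).
Proof. by move=> sA sB; apply/esym/cls_eq/T_cong_imp; apply: rep_cls. Qed.
Lemma cls_or A B : sentence A -> sentence B -> @f_or _ M (cls A) (cls B) = cls (Or A B).
Proof. by move=> sA sB; apply/esym/cls_eq/T_cong_or; apply: rep_cls. Qed.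
Lemma cls_and A B : sentence A -> sentence B -> @f_and _ M (cls A) (cls B) = cls (And A
  B).
Proof. by move=> sA sB; apply/esym/cls_eq/T_cong_and; apply: rep_cls. Qed.
Lemma cls_eqv A B : sentence A -> sentence B -> @f_eqv _ M (cls A) (cls B) = cls (Eqv A
  B).
Proof. by move=> sA sB; apply/esym/cls_eq/T_cong_eqv; apply: rep_cls. Qed.
Lemma cls_neg A : sentence A -> @f_neg _ M (cls A) = cls (Neg A).
Proof. by move=> sA; apply/esym/cls_eq/T_cong_neg; apply: rep_cls. Qed.
Lemma cls_box A : sentence A -> @f_box _ M (cls A) = cls (Box A).
Proof. by move=> sA; apply/esym/cls_eq/T_cong_box; apply: rep_cls. Qed.

Lemma clsW (P : M -> Prop) : (forall A, sentence A -> P (cls A)) -> forall a, P a.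
Proof. by move=> h a; rewrite -(repK a); apply: h. Qed.

Lemma leM_cls A B : sentence A -> sentence B -> @leM _ M (cls A) (cls B) <-> T (Box
  (Imp A B)).
Proof. by move=> sA sB; rewrite /leM cls_imp //; apply: NEC_cls; auto. Qed.

Lemma leM_haxiom A B : sentence A -> sentence B -> haxiom (Imp A B) -> @leM _ M (cls A)
  (cls B).
Proof. by move=> sA sB h; apply/leM_cls => //; apply: (ht_nec hT); auto. Qed.

(** * Boolean structure and truth *)

Lemma NEC_mp a b : NEC M (f_imp a b) -> NEC M a -> NEC M b.
Proof.
move: a b; apply: clsW => A sA; apply: clsW => B sB.
rewrite cls_imp //; rewrite !NEC_cls; auto; exact: N_mp.
Qed.

(** Boxed tautologies belong to [T], which reduces the Boolean laws of the model to truth tables. *)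
Lemma NEC_tautology (s : nat -> M) p : tautology p -> NEC M (pdenote s p).
Proof.
move=> tp; have -> : pdenote s p = cls (pinst (fun i => rep (s i)) p).
  have sp q : sentence (pinst (fun i => rep (s i)) q) by apply: sentence_pinst.
  elim: p {tp} => /= [n|||p ->|p -> q ->|p -> q ->|p -> q ->] //.
  - by rewrite repK.
  - exact: cls_neg.
  - exact: cls_imp.
  - exact: cls_or.
  - exact: cls_and.
apply/NEC_cls; [exact: sentence_pinst|exact: N_taut].
Qed.

Let val3 a b c (i : nat) : M := match i with 0 => a | 1 => b | _ => c end.
Let val4 a b c d (i : nat) : M := match i with 0 => a | 1 => b | 2 => c | _ => d end.

Ltac by_truth_table :=
  let v := fresh "v" in
  by intro v; simpl; case: (v 0); case: (v 1); case: (v 2); case: (v 3).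

Local Notation P0 := (PVar 0).
Local Notation P1 := (PVar 1).
Local Notation P2 := (PVar 2).
Local Notation P3 := (PVar 3).

Lemma le_pdenote a b c p q : tautology (PImp p q) ->
  leM (pdenote (val3 a b c) p) (pdenote (val3 a b c) q).
Proof. exact: (@NEC_tautology _ (PImp p q)). Qed.

Lemma eq_pdenote a b c p q : tautology (PAnd (PImp p q) (PImp q p)) ->
  eqM (pdenote (val3 a b c) p) (pdenote (val3 a b c) q).
Proof.
by move=> h; split; apply: le_pdenote => v; move: (h v) => /= /andP[].
Qed.

Lemma canonical_le_trans a b c : leM a b -> leM b c -> leM a c.
Proof.
move=> ab; apply: NEC_mp; apply: NEC_mp ab.
by apply: (@NEC_tautology (val3 a b c) (PImp (PImp P0 P1) (PImp (PImp P1 P2) (PImp P0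
  P2)))); by_truth_table.
Qed.

Lemma canonical_cong2 (op : M -> M -> M) (pop : pform -> pform -> pform) :
  (forall s p q, pdenote s (pop p q) = op (pdenote s p) (pdenote s q)) ->
  tautology (PImp (PImp P0 P1) (PImp (PImp P1 P0) (PImp (PImp P2 P3) (PImp (PImp P3 P2)
    (PImp (pop P0 P2) (pop P1 P3)))))) ->
  forall a a' b b' : M, eqM a a' -> eqM b b' -> eqM (op a b) (op a' b').
Proof.
move=> hop taut.
have le_op a a' b b' : eqM a a' -> eqM b b' -> leM (op a b) (op a' b').
  move=> [aa' a'a] [bb' b'b]; set s := val4 a a' b b'.
  have e : pdenote s (pop P0 P2) = op a b := hop s P0 P2.
  have e' : pdenote s (pop P1 P3) = op a' b' := hop s P1 P3.
  apply: NEC_mp b'b; apply: NEC_mp bb'; apply: NEC_mp a'a; apply: NEC_mp aa'.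
  by rewrite -e -e'; apply: (NEC_tautology s taut).
by move=> a a' b b' [? ?] [? ?]; split; apply: le_op.
Qed.

Lemma canonical_boolean : boolean_prealgebra M.
Proof.
split.
- by move=> a; apply: (@le_pdenote a a a P0 P0); by_truth_table.
- exact: canonical_le_trans.
- have le_neg a b : leM a b -> leM (f_neg b) (f_neg a).
    by apply: NEC_mp; apply: (@NEC_tautology (val3 a b a) (PImp (PImp P0 P1) (PImp
      (PNeg P1) (PNeg P0))));
      by_truth_table.
  by move=> a a' [? ?]; split; apply: le_neg.
- by apply: (@canonical_cong2 _ POr) => //; by_truth_table.
- by apply: (@canonical_cong2 _ PAnd) => //; by_truth_table.
- by apply: (@canonical_cong2 _ PImp) => //; by_truth_table.
- by move=> a b; apply: (@eq_pdenote a b a (POr P0 P1) (POr P1 P0)); by_truth_table.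
- by move=> a b; apply: (@eq_pdenote a b a (PAnd P0 P1) (PAnd P1 P0)); by_truth_table.
- by move=> a b c; apply: (@eq_pdenote a b c (POr P0 (POr P1 P2)) (POr (POr P0 P1)
    P2)); by_truth_table.
- by move=> a b c; apply: (@eq_pdenote a b c (PAnd P0 (PAnd P1 P2)) (PAnd (PAnd P0 P1)
    P2)); by_truth_table.
- by move=> a b; apply: (@eq_pdenote a b a (POr P0 (PAnd P0 P1)) P0); by_truth_table.
- by move=> a b; apply: (@eq_pdenote a b a (PAnd P0 (POr P0 P1)) P0); by_truth_table.
- by move=> a b c; apply: (@eq_pdenote a b c (PAnd P0 (POr P1 P2)) (POr (PAnd P0 P1)
    (PAnd P0 P2)));
    by_truth_table.
- by move=> a; apply: (@eq_pdenote a a a (POr P0 PBot) P0); by_truth_table.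
- by move=> a; apply: (@eq_pdenote a a a (PAnd P0 PTop) P0); by_truth_table.
- by move=> a; apply: (@eq_pdenote a a a (POr P0 (PNeg P0)) PTop); by_truth_table.
- by move=> a; apply: (@eq_pdenote a a a (PAnd P0 (PNeg P0)) PBot); by_truth_table.
- by move=> a b; apply: (@eq_pdenote a b a (PImp P0 P1) (POr (PNeg P0) P1));
    by_truth_table.
move=> a b; split=> [ab|[_ ab]].
  split; first by apply: (@le_pdenote a b a (PAnd P0 P1) P0); by_truth_table.
  apply: NEC_mp ab.
  by apply: (@NEC_tautology (val3 a b a) (PImp (PImp P0 P1) (PImp P0 (PAnd P0 P1))));
    by_truth_table.
apply: canonical_le_trans ab _.
by apply: (@le_pdenote a b a (PAnd P0 P1) P1); by_truth_table.
Qed.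

Let le_refl a : leM a a := bp_refl canonical_boolean a.

Lemma T_neg A : sentence A -> T (Neg A) <-> ~ T A.
Proof.
move=> sA; split=> [TnA TA|nA].
  apply: (ht_bot hT); apply: T_mp TA; apply: T_mp TnA.
  by apply: (@T_taut (PImp (PNeg P0) (PImp P0 PBot)) (fun=> A)) => //; by_truth_table.
apply: (@T_mp (Imp A (Cst (cbot HC)))); last by apply/(ht_imp hT).
by apply: (@T_taut (PImp (PImp P0 PBot) (PNeg P0)) (fun=> A)) => //; by_truth_table.
Qed.

Lemma T_and A B : sentence A -> sentence B -> T (And A B) <-> T A /\ T B.
Proof.
move=> sA sB; have hs i : sentence (nth A [:: A; B] i).
  by case: i => [|[|i]] //; rewrite nth_default.
split=> [TAB|[TA TB]].
  split; apply: T_mp TAB.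
  - by apply: (T_taut (p := PImp (PAnd P0 P1) P0) _ hs); by_truth_table.
  - by apply: (T_taut (p := PImp (PAnd P0 P1) P1) _ hs); by_truth_table.
apply: T_mp TB; apply: T_mp TA.
by apply: (T_taut (p := PImp P0 (PImp P1 (PAnd P0 P1))) _ hs); by_truth_table.
Qed.

Lemma T_or A B : sentence A -> sentence B -> T (Or A B) <-> T A \/ T B.
Proof.
move=> sA sB; have hs i : sentence (nth A [:: A; B] i).
  by case: i => [|[|i]] //; rewrite nth_default.
split=> [TAB|[TA|TB]].
- case: (pselect (T A)) => [|/(T_neg sA) nA]; [by left|right].
  apply: T_mp nA; apply: T_mp TAB.
  by apply: (T_taut (p := PImp (POr P0 P1) (PImp (PNeg P0) P1)) _ hs); by_truth_table.
- apply: T_mp TA.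
  by apply: (T_taut (p := PImp P0 (POr P0 P1)) _ hs); by_truth_table.
- apply: T_mp TB.
  by apply: (T_taut (p := PImp P1 (POr P0 P1)) _ hs); by_truth_table.
Qed.

(** * Representable functions and [f_all] *)

Lemma represents_cls t x A B : represents t (x, A) -> sentence B ->
  t (cls B) = cls (lsubst1 A x B).
Proof.
move=> [sA ->] sB; have [_ uA] := proj1 (sentence_all x A) sA.
by apply/esym/cls_eq/T_eqv_subst => //; apply: rep_cls.
Qed.

(** The schemas for [All] mention a single variable, while two representations may bind different
    ones; both can be renamed to any [z] that is large enough. *)
Lemma represents_rename t x A : represents t (x, A) ->
  exists n, forall z, n <= z ->
    represents t (z, lsubst1 A x (Var z)) /\
    cls (All x A) = cls (All z (lsubst1 A x (Var z))).
Proof.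
move=> [sA tA]; have [xA [FA hA]] := proj1 (sentence_all x A) sA.
exists (fresh (x :: fv A ++ bv A)) => z /mem_fresh.
rewrite inE mem_cat !negb_or => /and3P[zx zA zbv].
have nc : no_capture Cst (upd Var x (Var z)) A.
  apply: no_capture_bv => // v; rewrite /upd; case: eqP => _; [right=> y|by left].
  by rewrite inE => yA; apply: contraNneq zbv => <-.
have zAz : z \in fv (lsubst1 A x (Var z)).
  by apply: (fv_lsubst_mem (v := x)) => //; rewrite upd_same inE.
have sAz : sentence (All z (lsubst1 A x (Var z))).
  apply/sentence_all; split=> //; split; first by apply: Fm_lsubst => // v;
    rewrite /upd; case: eqP.
  move=> u /fv_lsubst [[v /hA]|[]//]; rewrite inE => /eqP ->.
  by rewrite upd_same.
split; last first.
  by apply/cls_eq; apply: (ht_axiom hT); auto; apply: haxiom_rename.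
split=> // m; rewrite tA /=; congr cls; rewrite /lsubst1 lsubst_comp //.
apply: eq_lsubst => // v /hA; rewrite inE => /eqP -> /=.
by rewrite !upd_same /= upd_same.
Qed.

(** Over a common variable, [T] identifies all instances of the two formulas, as they denote the
    same values of [t]. The Henkin property yields the quantified identity, and [sch_eqv_all] the
    identity of the quantified formulas. *)
Lemma represents_all_eq t x A y B : represents t (x, A) -> represents t (y, B) ->
  cls (All x A) = cls (All y B).
Proof.
move=> /represents_rename [n hn] /represents_rename [m hm].
have [] := hn (maxn m n) ltac:(lia); have [] := hm (maxn m n) ltac:(lia).
set z := maxn m n; move: (lsubst1 A _ _) (lsubst1 B _ _) => A' B' rB -> rA ->.
have [[sA _] [sB _]] := (rA, rB); apply/cls_eq.
have [[zA uA] [zB uB]] := (proj1 (sentence_all z A') sA, proj1 (sentence_all z B') sB).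
have sAB : sentence (All z (Eqv A' B')).
  apply/sentence_all; split; first by rewrite mem_cat zA.
  case: uA uB => [FA fA] [FB fB]; split=> // u.
  by rewrite mem_cat => /orP[/fA|/fB].
apply: (@T_mp (All z (Eqv A' B'))).
  by apply: (ht_axiom hT); auto; apply: haxiom_eqv_all.
apply: (ht_all hT) => // D sD; apply/cls_eqP; try exact: sentence_lsubst1.
by rewrite -(represents_cls rA sD) -(represents_cls rB sD).
Qed.

Lemma f_all_represents t x A : represents t (x, A) -> f_all (d := M) t = cls (All x A).
Proof.
move=> r; rewrite /= /cls_all; case: pselect => [e|[]]; last by exists (x, A).
by case: (cid e) => -[y B] /= rB; apply: represents_all_eq rB r.
Qed.

Lemma f_all_unrepresented t : ~ (exists p, represents t p) -> f_all (d := M) t = t (cls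
  top).
Proof. by move=> h; rewrite /= /cls_all; case: pselect. Qed.

(** * Denotations and definable functions *)

Lemma unary_embed s x (A : form C) : Fm A -> (forall v, sentence (s v)) ->
  unary x (embed (upd s x (Var x)) A).
Proof.
move=> FA hs; split.
  by apply: Fm_lsubst => // v; rewrite /upd; case: eqP => // _; case: (hs v).
move=> u /fv_lsubst [[v _]|[]//]; rewrite /upd; case: eqP => // _.
by case: (hs v) => _ ->.
Qed.

Lemma lsubst1_embed s x (A : form C) B : (forall v, sentence (s v)) ->
  lsubst1 (embed (upd s x (Var x)) A) x B = embed (upd s x B) A.
Proof.
move=> hs; rewrite /lsubst1 lsubst_comp.
  apply: eq_lsubst => // v _; rewrite /upd; case: eqP => [_|_] /=;
    first by rewrite eqxx.
  by apply: lsubst_id => u; case: (hs v) => _ ->.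
apply: no_capture_bv => // v; rewrite /upd; case: eqP => [->|_]; [by left|right=> y _].
by case: (hs v) => _ ->.
Qed.

(** In the quantifier case well-formedness makes [x] occur, so the embedded body represents the
    function and [f_all] does not take its default. *)
Lemma den_cls (A : form C) (g : nat -> M) s : Fm A -> (forall v, sentence (s v)) ->
  (forall v, g v = cls (s v)) -> den g A = cls (embed s A).
Proof.
elim: A g s => [x|c|A IH|A IHA B IHB|A IHA B IHB|A IHA B IHB|A IHA B IHB|A IH|x A IH] g
  s FA hs gs.
- exact: gs.
- by [].
- by rewrite -[RHS]/(cls (Neg (embed s A))) -cls_neg -?(IH g s) //;
    apply: sentence_embed.
- case: FA => FA FB; rewrite -[RHS]/(cls (Imp (embed s A) (embed s B))).
  by rewrite -cls_imp -?(IHA g s) -?(IHB g s) //; apply: sentence_embed.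
- case: FA => FA FB; rewrite -[RHS]/(cls (Or (embed s A) (embed s B))).
  by rewrite -cls_or -?(IHA g s) -?(IHB g s) //; apply: sentence_embed.
- case: FA => FA FB; rewrite -[RHS]/(cls (And (embed s A) (embed s B))).
  by rewrite -cls_and -?(IHA g s) -?(IHB g s) //; apply: sentence_embed.
- case: FA => FA FB; rewrite -[RHS]/(cls (Eqv (embed s A) (embed s B))).
  by rewrite -cls_eqv -?(IHA g s) -?(IHB g s) //; apply: sentence_embed.
- by rewrite -[RHS]/(cls (Box (embed s A))) -cls_box -?(IH g s) //;
    apply: sentence_embed.
case: FA => xA FA; apply: f_all_represents; split.
  apply/sentence_all; split; last exact: unary_embed.
  by apply: fv_lsubst_var => //; rewrite upd_same.
move=> m; rewrite lsubst1_embed //; apply: IH => // v; rewrite /upd; case: eqP => // _.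
by rewrite repK.
Qed.

Lemma definable_by_unary (A : form C) x g t : definable_by A x g t ->
  let A' := embed (upd (fun v => rep (g v)) x (Var x)) A in
  [/\ unary x A', x \in fv A -> x \in fv A' & forall m, t m = cls (lsubst1 A' x (rep
    m))].
Proof.
move=> [FA tA]; split; first exact: unary_embed.
  by move=> xA; apply: fv_lsubst_var => //; rewrite upd_same.
move=> m; rewrite tA lsubst1_embed //; apply: den_cls => // v.
  by rewrite /upd; case: eqP.
by rewrite /upd; case: eqP => // _; rewrite repK.
Qed.

Lemma definable_by_represents (A : form C) x g t : x \in fv A -> definable_by A x g t ->
  exists A', represents t (x, A').
Proof.
move=> xA /definable_by_unary [uA xA' tA].
by eexists; split; last exact: tA; apply/sentence_all; auto.
Qed.

(** The split is on whether some formula represents [t], which is what [f_all] consults, and not on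
    the defining formula at hand. *)
Lemma definableP t : definable t ->
  (exists p, represents t p) \/
  (exists a, t = fun=> a) /\ f_all (d := M) t = t (cls top).
Proof.
move=> [A [x [g /definable_by_unary [uA _ tA]]]].
case: (pselect (exists p, represents t p)) => [|nr]; [by left|right; split].
  move: uA tA; set A' := embed _ A => uA tA.
  have xA : x \notin fv A'.
    by apply/negP => xA; apply: nr; exists (x, A'); split=> //; apply/sentence_all.
  by exists (cls A'); apply: funext => m; rewrite tA lsubst1_notin.
exact: f_all_unrepresented.
Qed.

Lemma f_all_le t a : definable t -> leM (f_all (d := M) t) (t a).
Proof.
move=> dt; case: (definableP dt) => [[[x A] r]|[[b ->] ->]]; last exact: le_refl.
rewrite (f_all_represents r) -(repK a) (represents_cls r) //.
have [sA _] := r; have [_ uA] := proj1 (sentence_all x A) sA.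
by apply: leM_haxiom; [|apply: sentence_lsubst1|apply: haxiom_inst].
Qed.

(** * Verification of the model conditions *)

Lemma canonical_truth : truth_conditions M.
Proof.
split.
- by move=> /TRUE_cls h; apply: (ht_bot hT); apply: h.
- apply/TRUE_cls => //; exact: (@T_taut PTop (fun=> top)).
- by move=> a b; rewrite TRUE_cls; auto; apply: (ht_imp hT).
- by move=> a; rewrite TRUE_cls; auto; apply: T_neg.
- by move=> a b; rewrite TRUE_cls; auto; apply: T_and.
- by move=> a b; rewrite TRUE_cls; auto; apply: T_or.
- by move=> a; rewrite TRUE_cls; auto.
- move=> a b; rewrite TRUE_cls; auto.
  by rewrite -(cls_eqP (sentence_rep a) (sentence_rep b)) !repK.
move=> t dt h; case: (definableP dt) => [[[x A] r]|[_ ->//]].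
have [sA _] := r; have [_ uA] := proj1 (sentence_all x A) sA.
rewrite (f_all_represents r); apply/TRUE_cls => //; apply: (ht_all hT) => // B sB.
by have := h (cls B); rewrite (represents_cls r sB) => /TRUE_cls; apply;
  apply: sentence_lsubst1.
Qed.

Lemma canonical_normal : normal M.
Proof. by exists (cls top); apply: (@NEC_tautology (fun=> cls top) PTop). Qed.

Lemma canonical_filter : nec_filter M.
Proof.
split=> [a Na|a b Na ab|a b Na Nb].
- apply: T_mp Na; apply: (ht_axiom hT); first by auto.
  by apply: haxiom_T; case: (sentence_rep a).
- exact: NEC_mp ab Na.
apply: NEC_mp Nb; apply: NEC_mp Na.
by apply: (@NEC_tautology (val3 a b a) (PImp P0 (PImp P1 (PAnd P0 P1))));
  by_truth_table.
Qed.

Lemma le_imp_trans a a' b c : leM a (f_imp b c) -> leM a' b -> leM a (f_imp a' c).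
Proof.
move=> h1 h2; apply: NEC_mp h2; apply: NEC_mp h1.
by apply: (@NEC_tautology (val4 a b c a') (PImp (PImp P0 (PImp P1 P2)) (PImp (PImp P3
  P1) (PImp P0 (PImp P3 P2)))));
  by_truth_table.
Qed.

Lemma sentence_all_imp x A B : sentence (All x A) -> unary x B -> sentence (All x (Imp
  A B)).
Proof.
move=> /sentence_all [xA [FA fA]] [FB fB]; apply/sentence_all; split.
  by rewrite mem_cat xA.
by split=> // u; rewrite mem_cat => /orP[/fA|/fB].
Qed.

Lemma represents_const_imp t x A b : represents t (x, A) ->
  represents (fun a => f_imp (d := M) b (t a)) (x, Imp (rep b) A).
Proof.
move=> r; have [/sentence_all [xA [FA fA]] _] := r; have [Fb fb] := sentence_rep b.
split=> [|m].
  apply/sentence_all; split=> /=; first by rewrite fb.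
  by split=> //=; rewrite fb.
have -> : lsubst1 (Imp (rep b) A) x (rep m) = Imp (rep b) (lsubst1 A x (rep m)).
  by rewrite /lsubst1 /= (@lsubst_id _ (rep b)) ?fb.
by rewrite (proj2 r) -cls_imp ?repK //; apply: sentence_lsubst1.
Qed.

(** An arbitrary element [b] is admissible, since [rep b] is a sentence and thus lacks [x]. *)
Lemma le_all_const t b x A : represents t (x, A) ->
  leM (f_all (d := M) (fun a => f_imp b (t a))) (f_imp b (f_all (d := M) t)).
Proof.
move=> r; have r' := represents_const_imp b r; have [[sA _] [sI _]] := (r, r').
rewrite (f_all_represents r) (f_all_represents r') -{2}(repK b) cls_imp //.
by apply: leM_haxiom; auto; apply: haxiom_all_const.
Qed.

Lemma represents_box t x A : represents t (x, A) ->
  represents (fun a => f_box (d := M) (t a)) (x, Box A).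
Proof.
move=> r; have [sA tA] := r; split=> // m; rewrite tA cls_box //.
by apply: sentence_lsubst1 => //; case/sentence_all: sA.
Qed.

Lemma definable_imp (A B : form C) x g t1 t2 : definable_by A x g t1 -> definable_by B
  x g t2 ->
  definable (fun a => f_imp (d := M) (t1 a) (t2 a)).
Proof.
move=> [FA h1] [FB h2]; exists (Imp A B), x, g; split=> // m.
by rewrite h1 h2.
Qed.

Lemma represents_imp t1 t2 x A B : represents t1 (x, A) -> represents t2 (x, B) ->
  represents (fun a => f_imp (d := M) (t1 a) (t2 a)) (x, Imp A B).
Proof.
move=> [sA h1] [/sentence_all [xB uB] h2]; split; first exact: sentence_all_imp.
have [_ uA] := proj1 (sentence_all x A) sA.
by move=> m; rewrite h1 h2 cls_imp //; apply: sentence_lsubst1.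
Qed.

Lemma represents_eqv t1 t2 x A B : represents t1 (x, A) -> represents t2 (x, B) ->
  represents (fun a => f_eqv (d := M) (t1 a) (t2 a)) (x, Eqv A B).
Proof.
move=> [sA h1] [/sentence_all [xB uB] h2]; split; first exact: (sentence_all_imp sA uB).
have [_ uA] := proj1 (sentence_all x A) sA.
by move=> m; rewrite h1 h2 cls_eqv //; apply: sentence_lsubst1.
Qed.

Lemma le_all_imp t1 t2 p q : represents t1 p -> represents t2 q ->
  leM (f_all (d := M) (fun a => f_imp (t1 a) (t2 a)))
      (f_imp (f_all (d := M) t1) (f_all (d := M) t2)).
Proof.
case: p q => [x A] [y B] /represents_rename [n hn] /represents_rename [m hm].
have [r1 _] := hn (maxn m n) ltac:(lia); have [r2 _] := hm (maxn m n) ltac:(lia).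
have r := represents_imp r1 r2; have [[s1 _] [s2 _] [s _]] := And3 r1 r2 r.
rewrite (f_all_represents r) (f_all_represents r1) (f_all_represents r2) cls_imp //.
by apply: leM_haxiom; auto; apply: haxiom_all_imp.
Qed.

(** The boxed instances give [All x (Box A)] by the Henkin property, and the Barcan axiom moves the
    box outside. *)
Lemma NEC_all t p : represents t p -> (forall a, NEC M (t a)) -> NEC M (f_all (d := M)
  t).
Proof.
case: p => [x A] r h; have [sA _] := r; have [_ uA] := proj1 (sentence_all x A) sA.
rewrite (f_all_represents r); apply/NEC_cls => //.
apply: (@T_mp (All x (Box A))).
  by apply: (ht_axiom hT); [apply: sentence_imp|apply: haxiom_barcan].
apply: (ht_all hT) => // B sB; have := h (cls B); rewrite (represents_cls r sB).
by move=> /NEC_cls; apply; apply: sentence_lsubst1.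
Qed.

Lemma le_NEC a b : NEC M b -> leM a b.
Proof.
by apply: NEC_mp; apply: (@NEC_tautology (val3 a b a) (PImp P1 (PImp P0 P1)));
  by_truth_table.
Qed.

Lemma NEC_eqv_refl a : NEC M (f_eqv a a).
Proof.
apply/NEC_cls; first by auto.
by apply: (ht_nec hT); auto; apply: haxiom_eqv_refl; case: (sentence_rep a).
Qed.

Lemma canonical_nec : nec_conditions M.
Proof.
split.
- by move=> a; apply/le_NEC/NEC_eqv_refl.
- move=> a b; apply: leM_haxiom; auto.
  by apply: haxiom_eqv_imp; [case: (sentence_rep a)|case: (sentence_rep b)].
- move=> t a b [A [x [g /definable_by_unary [uA _ tA]]]].
  move: uA tA; set A' := embed _ A => uA tA; rewrite !tA.
  case: (boolP (x \in fv A')) => xA; last by rewrite !lsubst1_notin //;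
    apply/le_NEC/NEC_eqv_refl.
  have [sa sb] := (sentence_lsubst1 uA (sentence_rep a), sentence_lsubst1 uA
    (sentence_rep b)).
  by rewrite cls_eqv //; apply: leM_haxiom; auto; apply: haxiom_eqv_subst.
- apply: clsW => A sA; rewrite cls_box //.
  by apply: leM_haxiom; auto; apply: haxiom_T; case: sA.
- apply: clsW => A sA; apply: clsW => B sB.
  rewrite (cls_imp sA sB) (cls_box (sentence_imp sA sB)) (cls_box sA) (cls_box sB).
  rewrite (cls_imp (sentence_box sA) (sentence_box sB)).
  by apply: leM_haxiom; auto; apply: haxiom_K; [case: sA|case: sB].
- apply: clsW => A sA; apply: clsW => B sB.
  rewrite (cls_imp sA sB) (cls_box (sentence_imp sA sB)) (cls_box sA) (cls_box sB).
  rewrite (cls_imp (sentence_box sA) (sentence_box sB)) cls_box; last by auto.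
  by apply: leM_haxiom; auto; apply: haxiom_S3; [case: sA|case: sB].
- move=> A B x g t1 t2 xA xB d1 d2.
  have [A' r1] := definable_by_represents xA d1;
    have [B' r2] := definable_by_represents xB d2.
  have r := represents_eqv r1 r2; have [[s1 _] [s2 _] [s _]] := And3 r1 r2 r.
  rewrite (f_all_represents r) (f_all_represents r1) (f_all_represents r2) cls_eqv //.
  by apply: leM_haxiom; auto; apply: haxiom_eqv_all.
- move=> A B x g t1 t2 d1 d2; have d := definable_imp d1 d2.
  have {}d1 : definable t1 by exists A, x, g.
  have {}d2 : definable t2 by exists B, x, g.
  (* If [t2] is not represented, its quantification is its value at top, and it suffices to
     instantiate the other two quantifications there. *)
  case: (definableP d2) => [[q r2]|[_ ->]].
    case: (definableP d1) => [[p r1]|[[a ->] ->]]; first exact: le_all_imp r1 r2.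
    by case: q r2 => y B'; apply: le_all_const.
  exact: le_imp_trans (f_all_le (cls top) d) (f_all_le (cls top) d1).
- by move=> t a; apply: f_all_le.
- move=> A B x g b t FA xA -> dB.
  have dt : definable t by exists B, x, g.
  case: (definableP dt) => [[[y B'] r]|[[c e] ->]]; first exact: le_all_const r.
  have d : definable (fun a => f_imp (den g A) (t a)).
    exists (Imp A B), x, g; case: dB => FB tB; split=> // m; rewrite tB.
    congr f_imp; apply: den_eq_fv => v vA; rewrite upd_neq //.
    by apply: contraNneq xA => <-.
  exact: (f_all_le (cls top) d).
- move=> t dt; case: (definableP dt) => [[[x A] r]|[[a e] ->]].
    have r' := represents_box r; have [[s _] [s' _]] := (r, r').
    rewrite (f_all_represents r) (f_all_represents r') cls_box //.
    by split; apply: leM_haxiom => //; [apply: haxiom_cbarcan|apply: haxiom_barcan].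
  have db : definable (fun a => f_box (t a)).
    by case: dt => A [x [g [FA tA]]]; exists (Box A), x, g; split=> // m; rewrite tA.
  rewrite e in db *; split; last exact: (f_all_le (cls top) db).
  (* Though [t] is constant and not represented, the constant function with value [f_box a] may be.
     Its quantification then lies above [f_box a], by distributing the quantified implication from
     [f_box a] to itself. *)
  case: (definableP db) => [[[y E] r]|[_ ->]]; last exact: le_refl.
  apply: NEC_mp (le_all_const (f_box a) r) _.
  by apply: (NEC_all (represents_const_imp (f_box a) r)) => m; apply: le_refl.
move=> t dt h; case: (definableP dt) => [[p r]|[_ ->//]]; exact: NEC_all r h.
Qed.

Lemma canonical_model : model_of L M.
Proof.
have h3 : S3_model M.
  split=> [_|||]; [exact: canonical_boolean|exact: canonical_truth
    |by move=> _; apply: canonical_filter|by move=> _; apply: canonical_nec].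
have h4 : L <> S3 -> S4_model M.
  move=> L3; split=> //; first exact: canonical_normal.
  apply: clsW => A sA; rewrite (cls_box sA) (cls_box (sentence_box sA)).
  by apply: leM_haxiom; auto; apply: haxiom_4 => //; case: sA.
have h5 : L = S5 -> S5_model M.
  move=> L5; split; first by apply: h4; rewrite L5.
  apply: clsW => A sA; rewrite (cls_box sA) (cls_neg (sentence_box sA)) cls_box;
    last by auto.
  by apply: leM_haxiom; auto; apply: haxiom_5 => //; case: sA.
case: L h4 h5 => [_ _|h _|_ h] //=; [exact: h|exact: h].
Qed.

Lemma canonical_satisfies (A : form C) : Fm A ->
  satisfies (M := M) (fun v => cls (henkin_var C v)) A <-> T (embed (@henkin_var C) A).
Proof.
move=> FA; rewrite /satisfies (@den_cls _ _ (@henkin_var C)) //.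
by apply: TRUE_cls; apply: sentence_embed.
Qed.

End Canonical.

(** * Completeness and the equivalence *)

Lemma completeness (C : constants) L (Phi : set (form C)) (phi : form C) :
  (forall psi, Phi psi -> Fm psi) -> Fm phi -> entails L Phi phi -> derives L Phi phi.
Proof.
move=> FPhi Fphi ent; apply: contrapT => nphi.
have [T [hT PhiT nT]] := henkin_theory_exists FPhi Fphi nphi.
apply: nT; apply/(canonical_satisfies hT) => //; apply: ent.
- exact: canonical_model.
- exact: canonical_normal.
- by move=> B PB; apply/(canonical_satisfies hT); [apply: FPhi|apply: PhiT].
Qed.

Theorem theorem28 (C : constants) (Phi : set (form C)) (phi : form C)
    (hPhi : forall psi : form C, Phi psi -> Fm psi) (hphi : Fm phi) :
  (entails S3 Phi phi <-> derives S3 Phi phi) /\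
  (entails S4 Phi phi <-> derives S4 Phi phi) /\
  (entails S5 Phi phi <-> derives S5 Phi phi).
Proof.
by split; [|split]; split; do [exact: completeness|exact: soundness].
Qed.
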